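(* Let $x\in\mathbb{R}^2$, $\alpha\in\mathcal{A}$, let $X^{x,\alpha}\in\omega(x,\alpha)$ with associated $k^{x,\alpha}$, and let $(a_n,b_n)$ be any of the time intervals (defined in the context) on which $X^{x,\alpha}(t)\in(0,\infty)e_{i(n)}$. (1) If $a_n=0$, then, for all $t\in[0,b_n]$, $$X^{x,\alpha}(t)=\overline{x}+\int_0^t\langle f(X^{x,\alpha}(s),\alpha(s)),e_{i(n)}\rangle e_{i(n)}\,ds,$$ $$k^{x,\alpha}(t)=x-\overline{x}+\int_0^t\langle f(X^{x,\alpha}(s),\alpha(s)),e_{i(n)}^\perp\rangle e_{i(n)}^\perp\,ds,$$ where the values at $t=0$ are understood as the right limits $X^{x,\alpha}(0^+)$, $k^{x,\alpha}(0^+)$, and $\overline{x}:=\lim_{t\to\infty}Z^x(t)$ with $Z^x$ the unique solution of $\dot Z^x=-\nabla d(Z^x)$, $Z^x(0)=x$. (2) If $a_n\ne0$, then, for all $t\in[a_n,b_n]$, $$X^{x,\alpha}(t)=\int_{a_n}^t\langle f(X^{x,\alpha}(s),\alpha(s)),e_{i(n)}\rangle e_{i(n)}\,ds,$$ $$k^{x,\alpha}(t)=k^{x,\alpha}(a_n)+\int_{a_n}^t\langle f(X^{x,\alpha}(s),\alpha(s)),e_{i(n)}^\perp\rangle e_{i(n)}^\perp\,ds.$$ (If $b_n=\infty$, the intervals $[0,b_n]$, $[a_n,b_n]$ are read as $[0,\infty)$, $[a_n,\infty)$.)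
   Context: $A$ is a compact metric space, $\mathcal{A}=L^\infty((0,\infty);A)$ (measurable controls), and $f:\mathbb{R}^2\times A\to\mathbb{R}^2$ is continuous with, for some $M>0$, $|f(x,a)|\le M$, $|f(x,a)-f(y,a)|\le M|x-y|$ for all $x,y\in\mathbb{R}^2$, $a\in A$. $O=(0,0)$, $e_E=(1,0)$, $e_N=(0,1)$, $e_W=(-1,0)$, $e_S=(0,-1)$, $e_i^\perp$ is the rotation of $e_i$ by angle $\pi/2$. $\Gamma=\{O\}\cup\bigcup_{i\in\{E,N,W,S\}}(0,\infty)e_i$, and $d(x)=x_1^2x_2^2$. For $\varepsilon>0$, $X^{x,\alpha,\varepsilon}$ is the unique solution of $\dot X=f(X,\alpha(t))-\frac1\varepsilon\nabla d(X)$, $X(0)=x$, and $k^{x,\alpha,\varepsilon}(t)=\frac1\varepsilon\int_0^t\nabla d(X^{x,\alpha,\varepsilon}(s))\,ds$. $\omega(x,\alpha)$ is the set of $X^{x,\alpha}\in H^1_{\rm loc}(0,\infty)$ such that $(X^{x,\alpha},k^{x,\alpha})$ is, for some $k^{x,\alpha}\in H^1_{\rm loc}(0,\infty)$, a subsequential limit as $\varepsilon\to0$ (locally uniformly on $(0,\infty)$) of $(X^{x,\alpha,\varepsilon},k^{x,\alpha,\varepsilon})$. Such $X^{x,\alpha}$ is continuous on $(0,\infty)$ with values in $\Gamma$. For $X^{x,\alpha}\in\omega(x,\alpha)$, write $(0,\infty)=\mathcal{Z}(X^{x,\alpha})\cup\bigcup_{0\le n\le l}(a_n,b_n)$ with $l$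 possibly infinite, where $\mathcal{Z}(X^{x,\alpha})=\{t\in(0,\infty):X^{x,\alpha}(t)=O\}$ is closed in $(0,\infty)$ and the $(a_n,b_n)$ are the connected components of its complement in $(0,\infty)$; for each $n$ there is $i(n)\in\{E,N,W,S\}$ with $X^{x,\alpha}(t)\in(0,\infty)e_{i(n)}$ for all $t\in(a_n,b_n)$. *)

(* Defs.v *)
From HB Require Import structures.
From mathcomp Require Export all_boot all_order all_algebra.
From mathcomp Require Export all_classical all_reals all_analysis.
Export Order.TTheory GRing.Theory Num.Theory.
Export numFieldNormedType.Exports.

Set Implicit Arguments.
Unset Strict Implicit.
Unset Printing Implicit Defensive.

Local Open Scope classical_set_scope.
Local Open Scope ring_scope.

Section plane.
Context {R : realType}.

Definition vec2 (u v : R) : 'rV[R]_2 := \row_(j < 2) (if j == 0 then u else v).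

(* The library norm on 'rV is the sup norm, hence a Euclidean one here. *)
Definition dot (u v : 'rV[R]_2) : R := \sum_(j < 2) u 0 j * v 0 j.
Definition enorm (u : 'rV[R]_2) : R := Num.sqrt (dot u u).

Definition perp (v : 'rV[R]_2) : 'rV[R]_2 := vec2 (- v 0 1) (v 0 0).

Definition gradient (g : 'rV[R]_2 -> R) (x : 'rV[R]_2) : 'rV[R]_2 :=
  \row_(j < 2) 'D_(delta_mx 0 j) g x.

Definition vintegral (a b : R) (g : R -> 'rV[R]_2) : 'rV[R]_2 :=
  \row_(j < 2) \int[@lebesgue_measure R]_(s in `[a, b]) g s 0 j.

Definition dpot (x : 'rV[R]_2) : R := x 0 0 ^+ 2 * x 0 1 ^+ 2.

End plane.

Inductive direction := East | North | West | South.

Definition unit_dir {R : realType} (i : direction) : 'rV[R]_2 :=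
  match i with
  | East => vec2 1 0
  | North => vec2 0 1
  | West => vec2 (-1) 0
  | South => vec2 0 (-1)
  end.

Definition open_ray {R : realType} (i : direction) : set 'rV[R]_2 :=
  [set r *: unit_dir i | r in `]0, +oo[ ].

Section sobolev.
Context {R : realType}.

Definition L2loc (u : R -> R) : Prop :=
  measurable_fun (`]0, +oo[%classic : set R) u /\
  locally_integrable `]0, +oo[ (fun t => u t ^+ 2).

Definition test_function (phi : R -> R) : Prop :=
  (forall n (t : R), derivable (derive1n n phi) t 1) /\
  exists2 K : set R, compact K /\ K `<=` `]0, +oo[ &
    forall t, ~ K t -> phi t = 0.

Definition weak_derivative (u v : R -> R) : Prop :=
  forall phi, test_function phi ->
    \int[@lebesgue_measure R]_(t in `]0, +oo[) (u t * derive1 phi t) =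
    - \int[@lebesgue_measure R]_(t in `]0, +oo[) (v t * phi t).

Definition H1loc (X : R -> 'rV[R]_2) : Prop :=
  forall j : 'I_2, L2loc (fun t => X t 0 j) /\
    exists2 v, L2loc v & weak_derivative (fun t => X t 0 j) v.

End sobolev.

Section dynamics.
Context {R : realType}.

(* Y' = F(t, Y), Y(0) = x on [0, +oo[ in the sense of Caratheodory: the right-
   hand side is in general only measurable in t. *)
Definition ode_solution (F : R -> 'rV[R]_2 -> 'rV[R]_2) (x : 'rV[R]_2)
    (Y : R -> 'rV[R]_2) : Prop :=
  {within `[0, +oo[, continuous Y} /\
  forall t : R, 0 <= t ->
    (forall j, (@lebesgue_measure R).-integrable `[0, t]
                 (fun s => (F s (Y s) 0 j)%:E)) /\
    Y t = x + vintegral 0 t (fun s => F s (Y s)).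

Context {A : metricType R}.

(* A class of L^oo((0, +oo); A) is represented by a Borel function, of which
   only the values on ]0, +oo[ matter.  As A is separable, every class has
   such a representative. *)
Definition control (alpha : R -> A) : Prop :=
  forall U : set A, open U -> measurable (`]0, +oo[ `&` alpha @^-1` U).

Definition penalized_solution (f : 'rV[R]_2 -> A -> 'rV[R]_2)
    (x : 'rV[R]_2) (alpha : R -> A) (eps : R) (Y : R -> 'rV[R]_2) : Prop :=
  ode_solution (fun t y => f y (alpha t) - eps^-1 *: gradient dpot y) x Y.

Definition penalization (eps : R) (Y : R -> 'rV[R]_2) (t : R) : 'rV[R]_2 :=
  eps^-1 *: vintegral 0 t (fun s => gradient dpot (Y s)).

Definition cvg_loc_unif (Y : nat -> R -> 'rV[R]_2) (X : R -> 'rV[R]_2) : Prop :=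
  forall K : set R, compact K -> K `<=` `]0, +oo[ ->
    {uniform K, Y @ \oo --> X}.

(* X belongs to omega(x, alpha) with associated k.  Only the values of X and k
   on ]0, +oo[ are constrained. *)
Definition omega_limit (f : 'rV[R]_2 -> A -> 'rV[R]_2)
    (x : 'rV[R]_2) (alpha : R -> A) (X k : R -> 'rV[R]_2) : Prop :=
  [/\ H1loc X, H1loc k &
    exists (eps : nat -> R) (Y : nat -> R -> 'rV[R]_2),
      [/\ (forall n, 0 < eps n) /\ eps @ \oo --> 0,
          forall n, penalized_solution f x alpha (eps n) (Y n),
          cvg_loc_unif Y X &
          cvg_loc_unif (fun n => penalization (eps n) (Y n)) k] ].

Definition time_interval (a : R) (b : \bar R) : set R :=
  [set t | a < t /\ (t%:E < b)%E].

Definition excursion (X : R -> 'rV[R]_2) (a : R) (b : \bar R) : Prop :=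
  let C := [set t | 0 < t /\ X t <> 0] in
  exists2 t0, C t0 & time_interval a b = connected_component C t0.

End dynamics.

(* Main.v *)
(* Let [e] be the direction of the ray carrying [X] during the excursion, and
   let [p = <Y, e>], [q = <Y, perp e>] for a penalized trajectory [Y], so that
   [p' = g - (2 / eps) p q^2] and [q' = h - (2 / eps) p^2 q] with [g], [h]
   bounded.  By dominated convergence [X + k = x + int f(X, alpha)], so it
   suffices to show that [<k, e>] is constant on the excursion.  There [p] is
   bounded below and [q] tends to 0, and integrating [(q^2)'] shows that
   [(1 / eps) int p^2 q^2], hence also [(1 / eps) int p q^2], tends to 0.

   When the excursion starts at time 0, the constant is found from [p^2 - q^2]:
   the singular terms cancel in its derivative, so that
   [|p^2 - q^2 - (p^2 - q^2)(x)| <= C t] uniformly in [eps], whereas the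
   gradient flow [Z] preserves [p^2 - q^2] and tends to the axes.  Hence
   [<X(0+), e>^2] and [<xbar, e>^2] agree, and [p] cannot change sign while
   [p^2 - q^2 > 0]. *)
From mathcomp Require Import measurable_realfun ring lra.
Require Import Defs.

Set Implicit Arguments.
Unset Strict Implicit.
Unset Printing Implicit Defensive.

Local Open Scope classical_set_scope.
Local Open Scope ring_scope.

(** * Calculus of primitives of bounded measurable functions *)

Section primitive.
Context {R : realType}.
Notation mu := (@lebesgue_measure R).
Implicit Types (a b s t c K : R) (u w phi psi : R -> R).

Lemma bounded_integrable s t phi K :
  measurable_fun `[s, t] phi -> (forall r, s <= r <= t -> `|phi r| <= K) ->
  mu.-integrable `[s, t] (EFin \o phi).
Proof.
move=> mphi bphi; apply: measurable_bounded_integrable => //.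
  exact: compact_finite_measure (@segment_compact _ _ _).
exists K; split; first by rewrite num_real.
move=> x Kx r /=; rewrite in_itv/= => sr.
by apply: le_trans (ltW Kx); apply: bphi.
Qed.

Lemma itv_length s t : s <= t -> fine (mu `[s, t]) = t - s.
Proof.
move=> st; rewrite lebesgue_measure_itv /= lte_fin.
case: ltP => //= ts; apply/eqP.
by rewrite eq_sym subr_eq0 eq_le st ts.
Qed.

Lemma normr_Rintegral_le s t phi K : s <= t ->
  measurable_fun `[s, t] phi -> (forall r, s <= r <= t -> `|phi r| <= K) ->
  `|\int[mu]_(r in `[s, t]) phi r| <= K * (t - s).
Proof.
move=> st mphi bphi; have iphi := bounded_integrable mphi bphi.
apply: le_trans (le_normr_Rintegral _ iphi) _ => //.
rewrite -(itv_length st) -Rintegral_cst//; apply: le_Rintegral => //.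
- by apply: integrable_norm.
- apply: (@bounded_integrable _ _ _ `|K|) => //; exact: measurable_cst.
Qed.

(** Encodes [u' = phi] almost everywhere by the integral identity, since the control, hence [phi],
    is only measurable. The bound [K] makes [u] Lipschitz, which is what the product rule below
    relies on. *)
Definition primitive a b u phi : Prop :=
  exists K, [/\ measurable_fun `[a, b] phi,
    forall r, a <= r <= b -> `|phi r| <= K &
    forall s t, a <= s -> s <= t -> t <= b ->
      u t - u s = \int[mu]_(r in `[s, t]) phi r].

Lemma primitive_integrable a b u phi s t : a <= s -> t <= b ->
  primitive a b u phi -> mu.-integrable `[s, t] (EFin \o phi).
Proof.
move=> sa tb [K [mphi bphi _]].
apply: integrableS (bounded_integrable mphi bphi) => //.
by apply: subset_itv; rewrite bnd_simp.
Qed.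

Lemma primitiveB a b u phi s t : a <= s -> s <= t -> t <= b ->
  primitive a b u phi -> u t - u s = \int[mu]_(r in `[s, t]) phi r.
Proof. by move=> sa st tb [K [_ _]]; apply. Qed.

Lemma primitive_subitv a b u phi s t : a <= s -> t <= b ->
  primitive a b u phi -> primitive s t u phi.
Proof.
move=> sa tb [K [mphi bphi uphi]]; exists K; split.
- apply: measurable_funS mphi => //.
  by apply: subset_itv; rewrite bnd_simp.
- by move=> r /andP[sr rt]; apply: bphi; rewrite (le_trans sa sr) (le_trans rt tb).
- by move=> s' t' ss' st' tt'; apply: uphi; [exact: le_trans ss'| |exact: le_trans tb].
Qed.

Lemma eq_primitive a b u w phi psi :
  (forall r, a <= r <= b -> u r = w r) ->
  (forall r, a <= r <= b -> phi r = psi r) ->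
  primitive a b u phi -> primitive a b w psi.
Proof.
move=> uw fg [K [mphi bphi uphi]]; exists K; split.
- apply: eq_measurable_fun mphi => r; rewrite inE/= in_itv/=; exact: fg.
- by move=> r ar; rewrite -fg// bphi.
- move=> s t sa st tb; rewrite -!uw ?uphi ?tb ?sa ?(le_trans sa) ?(le_trans st)//.
  apply: eq_Rintegral => r; rewrite inE/= in_itv/= => /andP[sr rt].
  by rewrite fg// (le_trans sa sr) (le_trans rt tb).
Qed.

Lemma integral_primitive a b phi c K :
  measurable_fun `[a, b] phi -> (forall r, a <= r <= b -> `|phi r| <= K) ->
  primitive a b (fun t => c + \int[mu]_(r in `[a, t]) phi r) phi.
Proof.
move=> mphi bphi; exists K; split => // s t sa st tb.
rewrite /= opprD addrACA subrr add0r.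
rewrite (_ : \int[mu]_(r in `[s, t]) phi r = \int[mu]_(r in `]s, t]) phi r).
  rewrite -(@Rintegral_itvB _ phi (BLeft a) (BRight t) s) ?bnd_simp//.
  apply: integrableS (bounded_integrable mphi bphi) => //.
  by apply: subset_itv; rewrite bnd_simp.
rewrite -Rintegral_itv_obnd_cbnd//.
apply: integrableS (bounded_integrable mphi bphi) => //.
by apply: subset_itv; rewrite bnd_simp.
Qed.

Lemma primitive_lipschitz a b u phi : primitive a b u phi ->
  exists2 K : R, 0 <= K & (forall r, a <= r <= b -> `|phi r| <= K) /\
  forall s t, a <= s <= b -> a <= t <= b -> `|u t - u s| <= K * `|t - s|.
Proof.
move=> up; have [K [mphi bphi uphi]] := up.
exists `|K| => //; split=> [r /bphi/le_trans|s t]; first by apply; rewrite ler_norm.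
wlog st : s t / s <= t.
  move=> H asb atb; case/orP: (le_total s t) => st; first exact: H.
  by rewrite distrC (distrC t); apply: H.
move=> /andP[sa _] /andP[_ tb]; rewrite uphi// (ger0_norm (_ : 0 <= t - s)) ?subr_ge0//.
have [? [mphi' bphi' _]] := primitive_subitv sa tb up.
apply: normr_Rintegral_le => // r /andP[sr rt].
by apply: le_trans (ler_norm _); apply: bphi; rewrite (le_trans sa sr) (le_trans rt tb).
Qed.

Lemma primitive_continuous a b u phi :
  primitive a b u phi -> {within `[a, b], continuous u}.
Proof.
move=> /primitive_lipschitz[K K0 [_ uK]].
have K1 : 0 < K + 1 by lra.
apply/subspace_continuousP => x /= xab; apply/cvgrPdist_lt => e e0; near=> y.
have yab : `[a, b]%classic y by near: y; exact: withinT.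
apply: le_lt_trans (uK _ _ _ _) _; try by move: yab xab; rewrite /= !in_itv.
rewrite (@le_lt_trans _ _ ((K + 1) * `|x - y|))//; first by rewrite ler_wpM2r// lerDl.
rewrite mulrC -ltr_pdivlMr//; near: y; apply: cvg_within; apply: (@nbhsx_ballx _ R^o).
exact: divr_gt0.
Unshelve. all: by end_near.
Qed.

Lemma primitive_measurable a b u phi :
  primitive a b u phi -> measurable_fun `[a, b] u.
Proof.
by move=> /primitive_continuous; exact: subspace_continuous_measurable_fun.
Qed.

Lemma primitive_linear a b u w phi psi c d :
  primitive a b u phi -> primitive a b w psi ->
  primitive a b (fun t => c * u t + d * w t) (fun t => c * phi t + d * psi t).
Proof.
move=> up wp; have [K [mphi bphi uphi]] := up; have [L [mpsi bpsi wpsi]] := wp.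
exists (`|c| * K + `|d| * L); split.
- by apply: measurable_funD; apply: measurable_funM => //; exact: measurable_cst.
- move=> r ar; apply: le_trans (ler_normD _ _) _; rewrite !normrM.
  by apply: lerD; apply: ler_wpM2l => //; [exact: bphi|exact: bpsi].
- move=> s t sa st tb; rewrite RintegralD//.
  + rewrite !RintegralZl//; try exact: (primitive_integrable sa tb); last 2 first.
      exact: (primitive_integrable sa tb wp).
      exact: (primitive_integrable sa tb up).
    rewrite -uphi// -wpsi//; ring.
  + rewrite (_ : _ \o _ = (fun x => c%:E * (EFin \o phi) x)%E)//.
    apply: integrableZl => //; exact: (primitive_integrable sa tb up).
  + rewrite (_ : _ \o _ = (fun x => d%:E * (EFin \o psi) x)%E)//.
    apply: integrableZl => //; exact: (primitive_integrable sa tb wp).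
Qed.

Lemma primitive_le a b u w phi psi s t : a <= s -> s <= t -> t <= b ->
  primitive a b u phi -> primitive a b w psi ->
  (forall r, s <= r <= t -> phi r <= psi r) -> u t - u s <= w t - w s.
Proof.
move=> sa st tb up wp le.
rewrite (primitiveB sa st tb up) (primitiveB sa st tb wp).
apply: le_Rintegral => //; first exact: (primitive_integrable sa tb up).
exact: (primitive_integrable sa tb wp).
Qed.

Lemma primitive_affine a b c d : primitive a b (fun t => c * t + d) (fun=> c).
Proof.
exists `|c|; split=> // s t sa st tb; rewrite Rintegral_cst// itv_length//; ring.
Qed.

(** Cutting [[a, b]] into [n + 1] equal pieces bounds the total increment by [n + 1] terms of order
    [1 / (n + 1)^2], hence by a multiple of [1 / (n + 1)]. *)
Lemma quadratic_increments_constant a b (F : R -> R) K : a <= b ->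
  (forall s t, a <= s -> s <= t -> t <= b -> `|F t - F s| <= K * (t - s) ^+ 2) ->
  F b = F a.
Proof.
move=> ab FK.
have K0 : 0 <= K * (b - a) ^+ 2 by apply: le_trans (FK a b _ _ _).
have step n : `|F b - F a| <= K * (b - a) ^+ 2 / n.+1%:R.
  pose h := (b - a) / n.+1%:R.
  have h0 : 0 <= h by rewrite divr_ge0// subr_ge0.
  have tele m : (m <= n.+1)%N -> `|F (a + h * m%:R) - F a| <= m%:R * (K * h ^+ 2).
    elim: m => [|m IH] mn; first by rewrite mulr0 addr0 subrr normr0 mul0r.
    rewrite -(subrKA (F (a + h * m%:R))).
    apply: le_trans (ler_normD _ _) _.
    rewrite -natr1 mulrDl mul1r addrC; apply: lerD; first exact: IH (ltnW mn).
    have -> : h ^+ 2 = (a + h * (m%:R + 1) - (a + h * m%:R)) ^+ 2 by ring.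
    apply: FK; first by rewrite lerDl mulr_ge0.
      by rewrite lerD2l ler_wpM2l// lerDl.
    rewrite natr1 -lerBrDl /h mulrAC ler_pdivrMr// ler_wpM2l ?subr_ge0//.
    by rewrite ler_nat.
  have := tele n.+1 (leqnn _).
  have n0 : n.+1%:R != 0 :> R by rewrite pnatr_eq0.
  rewrite (_ : a + h * n.+1%:R = b); last by rewrite /h; field.
  by rewrite (_ : n.+1%:R * (K * h ^+ 2) = K * (b - a) ^+ 2 / n.+1%:R)// /h; field.
apply/eqP; rewrite -subr_eq0 -normr_le0 leNgt; apply/negP => F0.
set D := `|_| in F0 step; set C := K * _ in K0 step.
have [n] : exists n : nat, C / D < n.+1%:R.
  exists (Num.trunc (C / D)); apply: truncnS_gt.
rewrite ltr_pdivrMr// => /lt_le_trans Cn.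
have := step n; rewrite ler_pdivlMr// mulrC => /Cn; by rewrite ltxx.
Qed.

(** Product rule: the product minus the integral of the expected density has increments of second
    order, because [u] and [w] are Lipschitz, hence it is constant. *)
Lemma primitive_mul a b u w phi psi :
  primitive a b u phi -> primitive a b w psi ->
  primitive a b (fun t => u t * w t) (fun t => u t * psi t + phi t * w t).
Proof.
move=> up wp; have [K K0 [bphi uK]] := primitive_lipschitz up.
have [L L0 [bpsi wL]] := primitive_lipschitz wp.
have mu_u := primitive_measurable up; have mu_w := primitive_measurable wp.
have mI : measurable_fun `[a, b] (fun t => u t * psi t + phi t * w t).
  have [_ [? _ _]] := up; have [_ [? _ _]] := wp.
  by apply: measurable_funD; apply: measurable_funM.
pose C := (`|u a| + K * (b - a)) * L + K * (`|w a| + L * (b - a)).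
have bI r : a <= r <= b -> `|u r * psi r + phi r * w r| <= C.
  move=> arb; have /andP[ar rb] := arb; have ab := le_trans ar rb.
  have bd v N : 0 <= N -> (forall s t, a <= s <= b -> a <= t <= b ->
      `|v t - v s| <= N * `|t - s|) -> `|v r| <= `|v a| + N * (b - a).
    move=> N0 vN; rewrite -[v r](subrK (v a)) addrC; apply: le_trans (ler_normD _ _) _.
    rewrite lerD2l; apply: le_trans (vN _ _ _ _) _; rewrite ?lexx//.
    by rewrite ler_wpM2l// ger0_norm ?subr_ge0// lerD2r.
  apply: le_trans (ler_normD _ _) _; rewrite !normrM.
  by apply: lerD; apply: ler_pM; rewrite ?bd ?bphi ?bpsi.
exists C; split=> // s t sa st tb.
have := integral_primitive 0 mI bI; set G := fun t : R => _; move=> Gp.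
rewrite -(primitiveB sa st tb Gp).
pose F t := u t * w t - G t.
have : F t = F s.
  apply: (@quadratic_increments_constant _ _ _ (K * L + K * L)) => // s' t' ss' st' tt'.
  have sa' := le_trans sa ss'; have tb' := le_trans tt' tb.
  (* The increment of [u w] over [[s', t']] is [u(t') (w(t') - w(s')) + w(s') (u(t') - u(s'))]; with
     these frozen factors the integrand becomes [(u(t') - u) psi + phi (w(s') - w)], which is of
     order [t' - s']. *)
  have := primitive_linear (u t') (w s') wp up => lp.
  have Hp := primitive_linear 1 (-1) lp Gp.
  have -> : F t' - F s' = (1 * (u t' * w t' + w s' * u t') + -1 * G t') -
      (1 * (u t' * w s' + w s' * u s') + -1 * G s') by rewrite /F; ring.
  rewrite (primitiveB sa' st' tb' Hp) expr2 mulrA.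
  have [? [mH _ _]] := primitive_subitv sa' tb' Hp.
  apply: normr_Rintegral_le => // r /andP[sr rt].
  have ar := le_trans sa' sr; have rb := le_trans rt tb'.
  rewrite (_ : _ + _ = (u t' - u r) * psi r + phi r * (w s' - w r)); last by ring.
  apply: le_trans (ler_normD _ _) _; rewrite !normrM mulrDl; apply: lerD.
    rewrite mulrAC; apply: ler_pM => //; last by rewrite bpsi// ar.
    apply: le_trans (uK _ _ _ _) _; rewrite ?ar ?rb ?tb' ?(le_trans ar rt)//.
    by rewrite ler_wpM2l// ger0_norm ?subr_ge0// lerD2l lerN2.
  rewrite -mulrA; apply: ler_pM => //; first by rewrite bphi// ar.
  apply: le_trans (wL _ _ _ _) _; rewrite ?ar ?rb ?sa' ?(le_trans sr rb)//.
  by rewrite ler_wpM2l// distrC ger0_norm ?subr_ge0// lerD2r.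
rewrite /F => Fts; lra.
Qed.

End primitive.

(** * Comparison and sign arguments for primitives *)

Section primitive_calculus.
Context {R : realType}.
Implicit Types (a b s t c K : R) (u w phi psi : R -> R).

Lemma primitive_sqr a b u phi : primitive a b u phi ->
  primitive a b (fun t => u t ^+ 2) (fun t => 2 * (u t * phi t)).
Proof.
move=> up; apply: eq_primitive (primitive_mul up up) => r _; ring.
Qed.

Lemma primitive_le_linear a b u phi K s t : a <= s -> s <= t -> t <= b ->
  primitive a b u phi -> (forall r, s <= r <= t -> phi r <= K) ->
  u t - u s <= K * (t - s).
Proof.
move=> sa st tb up phiK.
apply: le_trans (primitive_le sa st tb up (primitive_affine a b K 0) phiK) _.
by rewrite le_eqVlt; apply/orP; left; apply/eqP; ring.
Qed.

Lemma nonvanishing_lt0 a b u t : {within `[a, b], continuous u} ->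
  (forall r, a <= r <= b -> u r != 0) -> u a < 0 -> a <= t <= b -> u t < 0.
Proof.
move=> cu u0 ua /andP[ta tb]; rewrite ltNge; apply/negP => ut.
have cu' : {within `[a, t], continuous u}.
  apply: continuous_subspaceW cu => r /=; rewrite !in_itv/= => /andP[-> rt].
  exact: le_trans tb.
have [|r] := IVT ta cu' (v := 0).
  by rewrite ge_min (ltW ua) le_max ut orbT.
rewrite in_itv/= => /andP[ar rt] ur0.
by have := u0 r; rewrite ur0 eqxx ar (le_trans rt tb) => /(_ isT).
Qed.

(* The pair [(p, q)] of coordinates of the penalized trajectory along and
   across a ray, with [c = 2 / eps]. *)
Definition penalized_pair c s t (p q g h : R -> R) : Prop :=
  primitive s t p (fun r => g r - c * (p r * q r ^+ 2)) /\
  primitive s t q (fun r => h r - c * (p r ^+ 2 * q r)).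

(** * Estimates on a penalized pair that are uniform in [c] *)

Section penalized_pair.
Context {c s t M : R} {p q g h : R -> R}.
Hypotheses (c_ge0 : 0 <= c) (pq : penalized_pair c s t p q g h).
Hypotheses (g_le : forall r, `|g r| <= M) (h_le : forall r, `|h r| <= M).

(** From [(q^2)' = 2 q h - 2 c p^2 q^2] and [delta <= p] one gets
    [2 delta c p q^2 <= 2 eta M - (q^2)']; integrate and use [q(s)^2 <= eta^2]. *)
Lemma transverse_penalization_small (delta eta : R) (kappa : R -> R) :
  s <= t -> 0 < delta -> (forall r, s <= r <= t -> delta <= p r) ->
  (forall r, s <= r <= t -> `|q r| <= eta) ->
  primitive s t kappa (fun r => c * (p r * q r ^+ 2)) ->
  0 <= kappa t - kappa s <= (2 * eta * M * (t - s) + eta ^+ 2) / (2 * delta).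
Proof.
move=> st d0 pd qe kp; have [_ /primitive_sqr q2] := pq.
have pos r : s <= r <= t -> 0 <= c * (p r * q r ^+ 2).
  move=> /pd dp; rewrite mulr_ge0// mulr_ge0 ?sqr_ge0//.
  exact: le_trans (ltW d0) dp.
apply/andP; split.
  have := primitive_le (lexx s) st (lexx t) (primitive_affine s t 0 0) kp pos.
  by rewrite !mul0r addr0 subrr.
have e0 : 0 <= eta by apply: le_trans (qe s _) => //; rewrite lexx.
have := primitive_linear (2 * eta * M) (-1) (primitive_affine s t 1 0) q2.
move=> /(primitive_le (lexx s) st (lexx t) (primitive_linear (2 * delta) 0 kp kp)) le.
rewrite ler_pdivlMr; last by rewrite mulr_gt0.
move: le; set A := (X in (X -> _) -> _); have : A.
  move=> r rst; have := pd r rst; have := qe r rst; move: (h_le r).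
  rewrite mul0r addr0 mulr1 ?mulN1r ler_norml => /andP[h1 h2] qr dp.
  have qh : q r * h r <= eta * M.
    apply: le_trans (ler_norm _) _; rewrite normrM; exact: ler_pM.
  have : 0 <= c * (p r * q r ^+ 2) * (p r - delta).
    by apply: mulr_ge0; [exact: pos|rewrite subr_ge0].
  have -> : 2 * (q r * (h r - c * (p r ^+ 2 * q r))) =
    2 * (q r * h r) - 2 * (c * (p r * q r ^+ 2) * p r) by ring.
  rewrite mulrBr; lra.
move=> HA /(_ HA); rewrite {A HA} !mul0r !addr0 => le.
have : q s ^+ 2 <= eta ^+ 2.
  by rewrite -real_normK ?num_real// ler_pXn2r ?nnegrE// qe// lexx.
have := sqr_ge0 (q t); nra.
Qed.

(** The singular terms only decrease [n = p^2 + q^2], so [n' <= n + 2 M^2]. At a maximum point [m]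
    of [n], a time span of at most [1/2] gives [n(m) - n(s) <= (n(m) + 2 M^2) / 2], which is solved
    for [n(m)]. *)
Lemma penalized_pair_bounded r : s <= t -> t - s <= 2^-1 -> s <= r <= t ->
  p r ^+ 2 + q r ^+ 2 <= 2 * (p s ^+ 2 + q s ^+ 2) + 2 * M ^+ 2.
Proof.
move=> st t2 rst; have [/primitive_sqr p2 /primitive_sqr q2] := pq.
have := primitive_linear 1 1 p2 q2; set n := fun r => _ => np.
have [m] := EVT_max st (primitive_continuous np).
rewrite in_itv/= => /andP[sm mt] nm.
have := primitive_le_linear (lexx s) sm mt np (K := n m + 2 * M ^+ 2).
set A := (X in (X -> _) -> _); have : A.
  move=> r' /andP[r1 r2].
  have : n r' <= n m by apply: nm; rewrite in_itv/= r1 (le_trans r2).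
  have gM : g r' ^+ 2 <= M ^+ 2.
    rewrite -real_normK ?num_real// ler_pXn2r ?nnegrE//.
    exact: le_trans (normr_ge0 _) (g_le r').
  have hM : h r' ^+ 2 <= M ^+ 2.
    rewrite -real_normK ?num_real// ler_pXn2r ?nnegrE//.
    exact: le_trans (normr_ge0 _) (h_le r').
  have := sqr_ge0 (p r' - g r'); have := sqr_ge0 (q r' - h r').
  have : 0 <= c * (p r' * q r') ^+ 2 by rewrite mulr_ge0// sqr_ge0.
  rewrite /n !mul1r; lra.
move=> HA /(_ HA); rewrite {A HA}.
have : n r <= n m by apply: nm; rewrite in_itv.
have M2 := sqr_ge0 M.
have nm0 : 0 <= n m by rewrite /n !mul1r addr_ge0 ?sqr_ge0.
have : (n m + 2 * M ^+ 2) * (m - s) <= (n m + 2 * M ^+ 2) * 2^-1.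
  rewrite ler_wpM2l//; [lra|].
  by apply: le_trans t2; rewrite lerD2r.
rewrite /n !mul1r; lra.
Qed.

(** The terms in [c] cancel: [(p^2 - q^2)' = 2 (p g - q h)], and [p], [q] are bounded independently
    of [c]. *)
Lemma hyperbolic_drift r : s <= t -> t - s <= 2^-1 -> s <= r <= t ->
  `|p r ^+ 2 - q r ^+ 2 - (p s ^+ 2 - q s ^+ 2)| <=
  4 * M * (1 + 2 * (p s ^+ 2 + q s ^+ 2) + 2 * M ^+ 2) * (r - s).
Proof.
move=> st t2 /andP[sr rt]; have [/primitive_sqr p2 /primitive_sqr q2] := pq.
have M0 : 0 <= M by apply: le_trans (g_le s).
(* [B - 1] bounds [p^2 + q^2]; the bound on [|p|] and [|q|] then follows from [2 |p| <= 1 + p^2],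
   without a square root. *)
set B := 1 + _ + _.
have pB r' : s <= r' <= r -> `|p r'| <= B.
  move=> /andP[r1 r2]; have := penalized_pair_bounded st t2 (r := r').
  rewrite r1 (le_trans r2 rt) => /(_ isT); have := sqr_ge0 (q r').
  have := normr_ge0 (p r'); have := sqr_ge0 (`|p r'| - 1).
  by rewrite sqrrB1 real_normK ?num_real// /B; lra.
have qB r' : s <= r' <= r -> `|q r'| <= B.
  move=> /andP[r1 r2]; have := penalized_pair_bounded st t2 (r := r').
  rewrite r1 (le_trans r2 rt) => /(_ isT); have := sqr_ge0 (p r').
  have := normr_ge0 (q r'); have := sqr_ge0 (`|q r'| - 1).
  by rewrite sqrrB1 real_normK ?num_real// /B; lra.
have b1 r' : s <= r' <= r -> `|p r' * g r'| <= M * B.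
  by move=> /pB pr; rewrite normrM mulrC ler_pM.
have b2 r' : s <= r' <= r -> `|q r' * h r'| <= M * B.
  by move=> /qB pr; rewrite normrM mulrC ler_pM.
rewrite ler_norml; apply/andP; split.
  have := primitive_le_linear (lexx s) sr rt (primitive_linear (-1) 1 p2 q2)
    (K := 4 * M * B).
  set A := (X in (X -> _) -> _); have : A.
    move=> r' rr; have := b1 _ rr; have := b2 _ rr.
    rewrite !ler_norml => /andP[? ?] /andP[? ?]; lra.
  by move=> HA /(_ HA); rewrite !mulN1r !mul1r; lra.
have := primitive_le_linear (lexx s) sr rt (primitive_linear 1 (-1) p2 q2)
  (K := 4 * M * B).
set A := (X in (X -> _) -> _); have : A.
  move=> r' rr; have := b1 _ rr; have := b2 _ rr.
  rewrite !ler_norml => /andP[? ?] /andP[? ?]; lra.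
by move=> HA /(_ HA); rewrite !mulN1r !mul1r; lra.
Qed.

End penalized_pair.

(** * The unforced pair: conservation law and decay *)

Lemma gradient_flow_conserved c s t (p q : R -> R) : s <= t ->
  penalized_pair c s t p q (fun=> 0) (fun=> 0) ->
  p t ^+ 2 - q t ^+ 2 = p s ^+ 2 - q s ^+ 2.
Proof.
move=> st [/primitive_sqr p2 /primitive_sqr q2].
have H := primitive_linear 1 (-1) p2 q2.
have : primitive s t (fun r => 1 * p r ^+ 2 + -1 * q r ^+ 2) (fun=> 0).
  by apply: eq_primitive H => // r _; ring.
move=> /primitiveB => /(_ _ _ (lexx s) st (lexx t)).
rewrite Rintegral_cst// mul0r !mulN1r !mul1r; lra.
Qed.

(* [p^2 q^2] is nonincreasing and [2 c p^2 q^2] is the rate of decrease of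
   [q^2], so [2 c (t - s) p(t)^2 q(t)^2 <= q(s)^2]. *)
Lemma gradient_flow_decay c s t (p q : R -> R) : 0 <= c -> s <= t ->
  penalized_pair c s t p q (fun=> 0) (fun=> 0) ->
  0 <= p s ^+ 2 - q s ^+ 2 ->
  2 * c * (t - s) * q t ^+ 4 <= q s ^+ 2.
Proof.
move=> c0 st pq D0; have [/primitive_sqr p2 /primitive_sqr q2] := pq.
have D := gradient_flow_conserved st pq.
have pdec r : s <= r <= t -> p t ^+ 2 <= p r ^+ 2.
  move=> /andP[sr rt]; rewrite -subr_le0.
  have := primitive_le_linear sr rt (lexx t) p2 (K := 0); rewrite mul0r; apply.
  move=> r' _; have : 0 <= c * (p r' * q r') ^+ 2 by rewrite mulr_ge0// sqr_ge0.
  lra.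
have qdec r : s <= r <= t -> q t ^+ 2 <= q r ^+ 2.
  move=> /andP[sr rt]; rewrite -subr_le0.
  have := primitive_le_linear sr rt (lexx t) q2 (K := 0); rewrite mul0r; apply.
  move=> r' _; have : 0 <= c * (p r' * q r') ^+ 2 by rewrite mulr_ge0// sqr_ge0.
  lra.
have := primitive_le_linear (lexx s) st (lexx t) q2
  (K := - (2 * c * (p t ^+ 2 * q t ^+ 2))).
set A := (X in (X -> _) -> _); have : A.
  move=> r rr.
  have : p t ^+ 2 * q t ^+ 2 <= p r ^+ 2 * q r ^+ 2.
    by apply: ler_pM; rewrite ?sqr_ge0 ?pdec ?qdec.
  move=> /(ler_wpM2l c0); lra.
move=> HA /(_ HA) {A HA}.
(* The conserved quantity [p^2 - q^2] is nonnegative, so [q(t)^2 <= p(t)^2]. *)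
have : q t ^+ 4 <= p t ^+ 2 * q t ^+ 2.
  rewrite (_ : 4 = 2 + 2)%N// exprD; apply: ler_wpM2r; rewrite ?sqr_ge0//; lra.
have c2 : 0 <= 2 * c * (t - s) by rewrite mulr_ge0 ?subr_ge0// mulr_ge0.
move=> /(ler_wpM2l c2); have := sqr_ge0 (q t); lra.
Qed.

End primitive_calculus.

(** * Coordinates along and across a ray, and the gradient of the potential *)

Section rays.
Context {R : realType}.
Implicit Types (u v y : 'rV[R]_2) (i : direction).

Lemma ord2E (j : 'I_2) : j = 0 \/ j = 1.
Proof. by case: j => [[|[|//]] ?]; [left|right]; apply/val_inj. Qed.

Lemma dotE u v : dot u v = u 0 0 * v 0 0 + u 0 1 * v 0 1.
Proof.
rewrite /dot big_ord_recl big_ord1.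
by rewrite (_ : lift _ _ = 1)//; apply/val_inj.
Qed.

Lemma dotDl u v w : dot (u + v) w = dot u w + dot v w.
Proof. rewrite !dotE !mxE; ring. Qed.

Lemma dotBl u v w : dot (u - v) w = dot u w - dot v w.
Proof. rewrite !dotE !mxE; ring. Qed.

Lemma dotZl (r : R) u v : dot (r *: u) v = r * dot u v.
Proof. rewrite !dotE !mxE; ring. Qed.

Lemma unit_dir_perpE i :
  [/\ dot (unit_dir i) (unit_dir i) = 1 :> R,
      dot (unit_dir i) (perp (unit_dir i)) = 0 :> R,
      dot (perp (unit_dir i)) (perp (unit_dir i)) = 1 :> R &
      dot (perp (unit_dir i)) (unit_dir i) = 0 :> R].
Proof. by split; case: i; rewrite dotE !mxE /=; ring. Qed.

Lemma ray_decomposition u i :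
  u = dot u (unit_dir i) *: unit_dir i +
      dot u (perp (unit_dir i)) *: perp (unit_dir i).
Proof.
by apply/rowP => j; case: (ord2E j) => ->; case: i; rewrite !dotE !mxE /=; ring.
Qed.

Lemma coord_le_enorm u (j : 'I_2) : `|u 0 j| <= enorm u.
Proof.
rewrite -sqrtr_sqr ler_wsqrtr// dotE.
have := sqr_ge0 (u 0 0); have := sqr_ge0 (u 0 1).
case: (ord2E j) => ->; rewrite !expr2; lra.
Qed.

Lemma enorm_le_coord u : enorm u <= `|u 0 0| + `|u 0 1|.
Proof.
rewrite -[leRHS]ger0_norm ?addr_ge0// -sqrtr_sqr ler_wsqrtr// dotE.
have := mulr_ge0 (normr_ge0 (u 0 0)) (normr_ge0 (u 0 1)).
rewrite sqrrD !real_normK ?num_real// !expr2; lra.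
Qed.

Lemma dot_unit_dir_le_enorm u i : `|dot u (unit_dir i)| <= enorm u.
Proof.
have := coord_le_enorm u 0; have := coord_le_enorm u 1.
by case: i; rewrite dotE !mxE /= ?(mulr0, add0r, addr0, mulr1, mulrN1, normrN).
Qed.

Lemma dot_perp_le_enorm u i : `|dot u (perp (unit_dir i))| <= enorm u.
Proof.
have := coord_le_enorm u 0; have := coord_le_enorm u 1.
by case: i;
  rewrite dotE !mxE /= ?(opprK, oppr0, mulr0, add0r, addr0, mulr1, mulrN1, normrN).
Qed.

(** In ['I_2], [1 - j] is the other index. For [h != 0] the difference quotient is exactly the
    claimed value plus [h] times the square of the other coordinate. *)
Lemma derive_dpot (j : 'I_2) y :
  'D_(delta_mx 0 j) dpot y = 2 * y 0 j * y 0 (1 - j) ^+ 2.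
Proof.
have dj : (1 - j == j) = false by case: (ord2E j) => ->.
have dpotE z : dpot z = z 0 j ^+ 2 * z 0 (1 - j) ^+ 2 :> R.
  rewrite /dpot; case: (ord2E j) => ->; rewrite ?subr0 ?subrr//; exact: mulrC.
apply: cvg_lim => //.
have lim0 : 2 * y 0 j * y 0 (1 - j) ^+ 2 + h * y 0 (1 - j) ^+ 2 @[h --> (0:R)^'] -->
    2 * y 0 j * y 0 (1 - j) ^+ 2 + 0 * y 0 (1 - j) ^+ 2.
  apply: cvg_within_filter; apply: cvgD; first exact: cvg_cst.
  by apply: cvgM; [exact: cvg_id|exact: cvg_cst].
rewrite mul0r addr0 in lim0; apply: cvg_trans lim0; apply: near_eq_cvg.
near=> h; have h0 : h != 0 by near: h; exact: nbhs_dnbhs_neq.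
rewrite /= !dpotE !mxE dj !eqxx /= /GRing.scale/=.
by move: (y 0 j) (y 0 (1 - j)) => a b; field.
Unshelve. all: by end_near. Qed.

Lemma gradient_dpotE y (j : 'I_2) : gradient dpot y 0 j = 2 * y 0 j * y 0 (1 - j) ^+ 2.
Proof. by rewrite mxE derive_dpot. Qed.

(** The potential is [p^2 q^2] in each of the four rotated frames, so one pair of equations serves
    all four rays. *)
Lemma dot_gradient_dpot y i :
  dot (gradient dpot y) (unit_dir i) =
  2 * (dot y (unit_dir i) * dot y (perp (unit_dir i)) ^+ 2).
Proof.
by rewrite !dotE !gradient_dpotE subr0 subrr; case: i; rewrite !mxE /=; ring.
Qed.

Lemma perp_gradient_dpot y i :
  dot (gradient dpot y) (perp (unit_dir i)) =
  2 * (dot y (unit_dir i) ^+ 2 * dot y (perp (unit_dir i))).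
Proof.
by rewrite !dotE !gradient_dpotE subr0 subrr; case: i; rewrite !mxE /=; ring.
Qed.

Lemma open_rayP y i : open_ray i y ->
  0 < dot y (unit_dir i) /\ dot y (perp (unit_dir i)) = 0.
Proof.
move=> [r /=]; rewrite in_itv/= andbT => r0 <-.
by rewrite !dotZl; have [-> -> _ _] := unit_dir_perpE i; rewrite mulr1 mulr0.
Qed.

End rays.

(** * Caratheodory solutions driven by a bounded forcing and a multiple of the gradient *)

Section ode.
Context {R : realType}.
Notation mu := (@lebesgue_measure R).
Implicit Types (Y : R -> 'rV[R]_2) (x v : 'rV[R]_2).

Lemma ode_coord_continuous F x Y t (j : 'I_2) : ode_solution F x Y ->
  {within `[0, t], continuous (fun s => Y s 0 j)}.
Proof.
move=> [cY _] s; apply: (@continuous_comp _ _ _ (Y : subspace `[0, t] -> _)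
  (fun u : 'rV[R]_2 => u 0 j)); last exact: coord_continuous.
apply: continuous_subspaceW cY s.
by move=> r /=; rewrite !in_itv/= => /andP[->].
Qed.

Lemma ode_init F x Y : ode_solution F x Y -> Y 0 = x.
Proof.
move=> [_ /(_ _ (lexx 0))[_ ->]]; apply/rowP => j.
by rewrite !mxE set_itv1 Rintegral_set1 addr0.
Qed.

Lemma within_itv_bounded s t (u : R -> R) : {within `[s, t], continuous u} ->
  exists K, forall r, s <= r <= t -> `|u r| <= K.
Proof.
move=> cu; have /compact_bounded[K [_ uK]] :=
  continuous_compact cu (@segment_compact _ s t).
exists (K + 1) => r sr; apply: uK; first by rewrite ltrDl.
by exists r => //=; rewrite in_itv.
Qed.

Section coefficients.
Context {F : R -> 'rV[R]_2 -> 'rV[R]_2} {G : R -> 'rV[R]_2} {c M : R}.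
Context {x : 'rV[R]_2} {Y : R -> 'rV[R]_2}.
Hypotheses (Y_sol : ode_solution F x Y).
Hypothesis FG : forall t, F t (Y t) = G t - c *: gradient dpot (Y t).

Let ode_coordE t (j : 'I_2) :
  F t (Y t) 0 j = G t 0 j - c * gradient dpot (Y t) 0 j.
Proof. by rewrite FG; move: (gradient _ _) => u; rewrite !mxE. Qed.

Lemma gradient_along_continuous (T : R) (j : 'I_2) :
  {within `[0, T], continuous (fun s => gradient dpot (Y s) 0 j)}.
Proof.
rewrite (_ : (fun s => _) = (fun s => (2 * Y s 0 j) * (Y s 0 (1 - j) * Y s 0 (1 - j)))).
  have /subspace_continuousP cj := ode_coord_continuous (j := j) (t := T) Y_sol.
  have /subspace_continuousP c1j := ode_coord_continuous (j := 1 - j) (t := T) Y_sol.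
  apply/subspace_continuousP => s sT; apply: cvgM.
    by apply: cvgM; [exact: cvg_cst|exact: cj].
  by apply: cvgM; exact: c1j.
by apply/funext => s; rewrite gradient_dpotE expr2.
Qed.

(** Measurability is read off the equation: the forcing is the integrable right-hand side plus a
    continuous term. *)
Lemma ode_forcing_measurable (T : R) (j : 'I_2) : 0 <= T ->
  measurable_fun `[0, T] (fun s => G s 0 j).
Proof.
move=> T0; have [/(_ j) /integrableP[/measurable_EFinP mF _] _] := Y_sol.2 T T0.
have mg := subspace_continuous_measurable_fun (measurable_itv _)
  (@gradient_along_continuous T j).
apply: eq_measurable_fun (measurable_funD mF (measurable_funM (measurable_cst c) mg)).
by move=> s _; rewrite /= ode_coordE subrK.
Qed.

Hypothesis G_bounded : forall t (j : 'I_2), `|G t 0 j| <= M.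

(** The density is bounded because the gradient is continuous along [Y] on [[0, T]]. This bound
    depends on [c] and [Y] and only gives access to the calculus of primitives. *)
Lemma ode_coord_primitive (T : R) (j : 'I_2) : 0 <= T ->
  primitive 0 T (fun s => Y s 0 j) (fun s => F s (Y s) 0 j).
Proof.
move=> T0; have [/(_ j) /integrableP[/measurable_EFinP mF _] _] := Y_sol.2 T T0.
have [K gK] := within_itv_bounded (@gradient_along_continuous T j).
have bF r : 0 <= r <= T -> `|F r (Y r) 0 j| <= M + `|c| * K.
  move=> r0T; rewrite ode_coordE.
  apply: le_trans (ler_normB _ _) _; rewrite normrM.
  by apply: lerD => //; rewrite ler_wpM2l// gK.
apply: eq_primitive (integral_primitive (x 0 j) mF bF) => // r /andP[r0 rT].
by have [_ ->] := Y_sol.2 r r0; rewrite !mxE.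
Qed.

(** Used for the penalized equation, with [c = 1 / eps] and [G] the controlled drift, and for the
    gradient flow, with [c = 1] and [G = 0]. The factor 2 comes from differentiating [p^2 q^2]. *)
Lemma ode_penalized_pair (T : R) i : 0 <= T ->
  penalized_pair (2 * c) 0 T (fun s => dot (Y s) (unit_dir i))
    (fun s => dot (Y s) (perp (unit_dir i)))
    (fun s => dot (G s) (unit_dir i)) (fun s => dot (G s) (perp (unit_dir i))).
Proof.
move=> T0.
have H v := primitive_linear (v 0 0) (v 0 1)
  (ode_coord_primitive 0 T0) (ode_coord_primitive 1 T0).
split; [apply: eq_primitive (H (unit_dir i))|
  apply: eq_primitive (H (perp (unit_dir i)))] => r _; try (rewrite dotE; ring).
- rewrite !ode_coordE.
  transitivity (dot (G r) (unit_dir i) - c * dot (gradient dpot (Y r)) (unit_dir i)).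
    rewrite [in RHS]dotE [dot (gradient _ _) _]dotE; ring.
  rewrite dot_gradient_dpot; ring.
- rewrite !ode_coordE.
  transitivity (dot (G r) (perp (unit_dir i)) -
      c * dot (gradient dpot (Y r)) (perp (unit_dir i))).
    rewrite [in RHS]dotE [dot (gradient _ _) _]dotE; ring.
  rewrite perp_gradient_dpot; ring.
Qed.

Lemma gradient_integral_primitive (T : R) (j : 'I_2) :
  primitive 0 T (fun s => (c *: vintegral 0 s (fun r => gradient dpot (Y r))) 0 j)
    (fun s => c * gradient dpot (Y s) 0 j).
Proof.
have [K gK] := within_itv_bounded (@gradient_along_continuous T j).
have mg := subspace_continuous_measurable_fun (measurable_itv _)
  (@gradient_along_continuous T j).
have gp := integral_primitive 0 mg gK.
apply: eq_primitive (primitive_linear c 0 gp gp) => r _; last by rewrite mul0r addr0.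
by rewrite [RHS]mxE [X in _ = _ * X]mxE /= mul0r addr0 add0r.
Qed.

Lemma penalization_primitive (T : R) i :
  primitive 0 T
    (fun s => dot (c *: vintegral 0 s (fun r => gradient dpot (Y r))) (unit_dir i))
    (fun s => 2 * c * (dot (Y s) (unit_dir i) * dot (Y s) (perp (unit_dir i)) ^+ 2)).
Proof.
have := primitive_linear ((unit_dir i : 'rV[R]_2) 0 0) ((unit_dir i : 'rV[R]_2) 0 1)
  (gradient_integral_primitive T 0) (gradient_integral_primitive T 1).
apply: eq_primitive => r _.
  rewrite dotE; ring.
transitivity (c * dot (gradient dpot (Y r)) (unit_dir i)).
  rewrite dotE; ring.
rewrite dot_gradient_dpot; ring.
Qed.

(** The gradient terms cancel in the sum, leaving an identity without singular terms that passes to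
    the limit. *)
Lemma ode_balance (t : R) (j : 'I_2) : 0 <= t ->
  Y t 0 j + (c *: vintegral 0 t (fun r => gradient dpot (Y r))) 0 j =
  x 0 j + \int[mu]_(s in `[0, t]) G s 0 j.
Proof.
move=> t0.
have := primitive_linear 1 1 (ode_coord_primitive j t0) (gradient_integral_primitive t j).
move=> /primitiveB => /(_ _ _ (lexx 0) t0 (lexx t)).
under [X in _ = X -> _]eq_Rintegral do
  rewrite !mul1r ode_coordE subrK.
move=> <-; rewrite (ode_init Y_sol) !mul1r.
have -> : (c *: vintegral 0 0 (fun r => gradient dpot (Y r))) 0 j = 0.
  by rewrite mxE [X in _ * X]mxE set_itv1 Rintegral_set1 mulr0.
ring.
Qed.

End coefficients.
End ode.

(** * Consequences of locally uniform convergence *)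

Section loc_unif.
Context {R : realType}.
Implicit Types (Y : nat -> R -> 'rV[R]_2) (X : R -> 'rV[R]_2) (u v : 'rV[R]_2).

Lemma cvg_loc_unif_enorm Y X (s t e : R) : cvg_loc_unif Y X -> 0 < s -> 0 < e ->
  \forall n \near \oo, forall r, s <= r <= t -> enorm (Y n r - X r) < e.
Proof.
move=> YX s0 e0.
have sub : `[s, t] `<=` `]0, +oo[%classic.
  by move=> r /=; rewrite !in_itv/= andbT => /andP[+ _]; exact: lt_le_trans.
(* Uniform convergence is expressed with balls of the sup norm; [enorm] is at most the sum of two
   coordinates, each below [e / 2]. *)
have e2 : 0 < e / 2 by rewrite divr_gt0.
apply: (YX _ (@segment_compact _ s t) sub
  [set h | forall r, s <= r <= t -> enorm (h r - X r) < e]).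
apply/uniform_nbhs.
exists [set uv | ball uv.1 (e / 2) uv.2]; split.
  exact: (entourage_ball _ (PosNum e2)).
move=> h Eh r srt.
have rst : `[s, t]%classic r by rewrite /= in_itv.
have [_ H] := Eh r rst.
apply: le_lt_trans (enorm_le_coord _) _; rewrite !mxE.
have := H 0 0; have := H 0 1; rewrite /ball/= => h1 h0.
rewrite -!(distrC (X r _ _)); lra.
Qed.

Lemma cvg_loc_unif_lipschitz Y X (F : 'rV[R]_2 -> R) (K t : R) :
  (forall u v, `|F u - F v| <= K * enorm (u - v)) ->
  cvg_loc_unif Y X -> 0 < t -> F (Y n t) @[n --> \oo] --> F (X t).
Proof.
move=> FK YX t0; apply/cvgrPdist_lt => e e0.
have K1 : 0 < `|K| + 1 by rewrite ltr_wpDl.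
have := cvg_loc_unif_enorm t YX t0 (divr_gt0 e0 K1).
apply: filterS => n /(_ t); rewrite lexx => /(_ isT).
rewrite ltr_pdivlMr// => lt; rewrite distrC.
apply: le_lt_trans (FK _ _) _; apply: le_lt_trans lt.
rewrite mulrC ler_wpM2l ?sqrtr_ge0//.
by apply: le_trans (ler_norm K) _; rewrite lerDl.
Qed.

Lemma coord_1lipschitz (j : 'I_2) u v : `|u 0 j - v 0 j| <= 1 * enorm (u - v).
Proof. by rewrite mul1r; have := coord_le_enorm (u - v) j; rewrite !mxE. Qed.

Lemma dot_unit_dir_1lipschitz i u v :
  `|dot u (unit_dir i) - dot v (unit_dir i)| <= 1 * enorm (u - v).
Proof. by rewrite mul1r -dotBl; exact: dot_unit_dir_le_enorm. Qed.

Lemma dot_perp_1lipschitz i u v :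
  `|dot u (perp (unit_dir i)) - dot v (perp (unit_dir i))| <= 1 * enorm (u - v).
Proof. by rewrite mul1r -dotBl; exact: dot_perp_le_enorm. Qed.

Lemma cvg_loc_unif_continuous Y X (s t : R) : 0 < s ->
  (forall n, {within `[0, +oo[, continuous (Y n)}) ->
  cvg_loc_unif Y X -> {within `[s, t], continuous X}.
Proof.
move=> s0 cY YX; apply: (@uniform_limit_continuous_subspace _ _ _ (Y @ \oo)).
  near_simpl; apply: nearW => n /=.
  refine (@continuous_subspaceW _ _ `[s, t] `[0, +oo[ (Y n) _ (cY n)) => r /=.
  by rewrite !in_itv/= andbT => /andP[+ _]; apply: le_trans; exact: ltW.
apply: YX; first exact: segment_compact.
by move=> r /=; rewrite !in_itv/= andbT => /andP[+ _]; exact: lt_le_trans.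
Qed.

(** Carries identities known inside an excursion to its end points, where [X] may leave the open
    ray. *)
Lemma continuous_itv_const (s t l : R) (u : R -> R) : s < t ->
  {within `[s, t], continuous u} -> (forall r, s < r < t -> u r = l) ->
  forall r, s <= r <= t -> u r = l.
Proof.
move=> st cu ul r.
have [_ us ut] := (continuous_within_itvP _ st).1 cu.
have es : u s = l.
  apply: (cvg_unique _ us) => //.
  apply: cvg_near_cst; near=> z; apply: ul; apply/andP; split; near: z.
    exact: nbhs_right_gt.
  exact: nbhs_right_lt.
have et : u t = l.
  apply: (cvg_unique _ ut) => //.
  apply: cvg_near_cst; near=> z; apply: ul; apply/andP; split; near: z.
    exact: nbhs_left_gt.
  exact: nbhs_left_lt.
rewrite le_eqVlt => /andP[/predU1P[<-//|sr]].
by rewrite le_eqVlt => /predU1P[->//|rt]; apply: ul; rewrite sr.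
Unshelve. all: by end_near. Qed.

End loc_unif.

(** * The hyperbolic quantity and its rate *)

Section hyperbolic.
Context {R : realType}.
Implicit Types (y : 'rV[R]_2) (i : direction).

(* [p^2 - q^2] is conserved by the gradient flow, and along penalized
   trajectories it varies at a rate which does not depend on [eps]. *)
Definition hyperbolic y i : R :=
  dot y (unit_dir i) ^+ 2 - dot y (perp (unit_dir i)) ^+ 2.

(** The constant of [hyperbolic_drift] for a trajectory starting at [y]. *)
Definition hyperbolic_rate (M : R) y i : R := 4 * M *
  (1 + 2 * (dot y (unit_dir i) ^+ 2 + dot y (perp (unit_dir i)) ^+ 2) + 2 * M ^+ 2).

End hyperbolic.

(** * Passage to the limit in the balance between [X], [k] and the drift *)

Section omega_limit.
Context {R : realType} {A : metricType R} {f : 'rV[R]_2 -> A -> 'rV[R]_2} {M : R}.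
Notation mu := (@lebesgue_measure R).
Hypothesis f_bounded : forall x c, enorm (f x c) <= M.
Hypothesis f_lipschitz : forall x y c, enorm (f x c - f y c) <= M * enorm (x - y).
Context {x : 'rV[R]_2} {alpha : R -> A} {X k : R -> 'rV[R]_2}.
Context {eps : nat -> R} {Y : nat -> R -> 'rV[R]_2}.
Hypothesis eps_gt0 : forall n, 0 < eps n.
Hypothesis Y_sol : forall n, penalized_solution f x alpha (eps n) (Y n).
Hypothesis Y_cvg : cvg_loc_unif Y X.
Hypothesis k_cvg : cvg_loc_unif (fun n => penalization (eps n) (Y n)) k.

Let drift_coord_le (W : R -> 'rV[R]_2) t (j : 'I_2) : `|f (W t) (alpha t) 0 j| <= M.
Proof. exact: le_trans (coord_le_enorm _ _) (f_bounded _ _). Qed.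

Lemma limit_drift_cvg (t : R) (j : 'I_2) : 0 < t ->
  f (Y n t) (alpha t) 0 j @[n --> \oo] --> f (X t) (alpha t) 0 j.
Proof.
move=> t0.
apply: (@cvg_loc_unif_lipschitz _ _ _ (fun u => f u (alpha t) 0 j) M) => // u v.
apply: le_trans (f_lipschitz u v (alpha t)).
by have := coord_le_enorm (f u (alpha t) - f v (alpha t)) j; rewrite !mxE.
Qed.

Let drift_measurable n (T : R) (j : 'I_2) : 0 <= T ->
  measurable_fun `[0, T] (fun s => f (Y n s) (alpha s) 0 j).
Proof. exact: (@ode_forcing_measurable _ _ _ _ _ _ (Y_sol n) (fun=> erefl)). Qed.

(** A pointwise limit of measurable functions on []0, T]]; the point 0, where [X] is arbitrary, is
    added separately. *)
Lemma limit_drift_measurable (T : R) (j : 'I_2) : 0 <= T ->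
  measurable_fun `[0, T] (fun s => f (X s) (alpha s) 0 j).
Proof.
move=> T0; rewrite -(@setU1itv _ _ _ _ false) ?bnd_simp//.
apply/measurable_funU => //; split; first exact: measurable_fun_set1.
apply: (@measurable_fun_cvg _ _ _ _ (fun n s => f (Y n s) (alpha s) 0 j)).
  move=> n; apply: measurable_funS (drift_measurable n j T0) => //.
  by apply: subset_itv; rewrite bnd_simp.
by move=> s /=; rewrite in_itv/= => /andP[s0 _]; exact: limit_drift_cvg.
Qed.

Lemma drift_integral_cvg (t : R) (j : 'I_2) : 0 <= t ->
  \int[mu]_(s in `[0, t]) f (Y n s) (alpha s) 0 j @[n --> \oo] -->
  \int[mu]_(s in `[0, t]) f (X s) (alpha s) 0 j.
Proof.
move=> t0.
have mX := limit_drift_measurable j t0.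
have [||||||iX _ cvg] := @dominated_convergence _ _ _ mu `[0, t] _
  (fun n s => (f (Y n s) (alpha s) 0 j)%:E) (fun s => (f (X s) (alpha s) 0 j)%:E)
  (fun=> M%:E).
- exact: measurable_itv.
- by move=> n; apply/measurable_EFinP; exact: drift_measurable.
- exact/measurable_EFinP.
(* Convergence is known for positive times only, so [{0}] is the exceptional null set. *)
- exists [set 0]; split => //; first exact: lebesgue_measure_set1.
  move=> s /= H; apply: contrapT => s0; apply: H; rewrite in_itv/= => /andP[s1 _].
  apply: cvg_EFin; first exact: nearW.
  by apply: limit_drift_cvg; rewrite lt_neqAle s1 andbT eq_sym; apply/eqP.
- by apply: (@bounded_integrable _ _ _ _ `|M|).
- by apply: aeW => s n _; rewrite /= lee_fin.
apply: fine_cvg; rewrite /= fineK//; exact: integrable_fin_num.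
Qed.

Lemma limit_balance (t : R) (j : 'I_2) : 0 < t ->
  X t 0 j + k t 0 j = x 0 j + \int[mu]_(s in `[0, t]) f (X s) (alpha s) 0 j.
Proof.
move=> t0.
have c1 : Y n t 0 j + penalization (eps n) (Y n) t 0 j @[n --> \oo] -->
    X t 0 j + k t 0 j.
  apply: cvgD.
    exact: (cvg_loc_unif_lipschitz (F := fun u => u 0 j) (coord_1lipschitz j) Y_cvg).
  exact: (cvg_loc_unif_lipschitz (F := fun u => u 0 j) (coord_1lipschitz j) k_cvg).
apply: (cvg_unique _ c1) => //.
rewrite (_ : (fun n => _) =
    fun n => x 0 j + \int[mu]_(s in `[0, t]) f (Y n s) (alpha s) 0 j).
  by apply: cvgD; [exact: cvg_cst|exact/drift_integral_cvg/ltW].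
apply/funext => n.
exact: (ode_balance (Y_sol n) (fun=> erefl) (drift_coord_le (Y n)) j (ltW t0)).
Qed.

Lemma limit_sum_primitive (s t : R) (w : 'rV[R]_2) : 0 < s ->
  primitive s t (fun r => dot (X r + k r) w) (fun r => dot (f (X r) (alpha r)) w).
Proof.
move=> s0; have [ts|st] := ltP t s.
  exists 0; split=> [|r /andP[sr rt]|s' t' ss st tt].
  - by rewrite set_itv_ge ?bnd_simp -?ltNge//; exact: measurable_fun_set0.
  - by have := le_lt_trans (le_trans sr rt) ts; rewrite ltxx.
  - by have := le_lt_trans (le_trans (le_trans ss st) tt) ts; rewrite ltxx.
have t0 : 0 <= t by apply: le_trans st; exact: ltW.
have H j : primitive s t (fun r => (X r + k r) 0 j) (fun r => f (X r) (alpha r) 0 j).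
  have := integral_primitive (x 0 j) (limit_drift_measurable j t0)
    (fun r _ => drift_coord_le X r j).
  move=> /(primitive_subitv (ltW s0) (lexx t)); apply: eq_primitive => // r /andP[sr _].
  by rewrite mxE limit_balance// (lt_le_trans s0).
apply: eq_primitive (primitive_linear (w 0 0) (w 0 1) (H 0) (H 1)) => r _;
  rewrite dotE; ring.
Qed.

Let M_ge0 : 0 <= M.
Proof. exact: le_trans (normr_ge0 _) (drift_coord_le (fun=> 0) 0 0). Qed.

(** As [X 0] and [k 0] are arbitrary, this function replaces [dot (X t + k t) w] up to time 0: it
    agrees with it for [t > 0] and equals [dot x w] at 0. *)
Lemma limit_drift_primitive (T : R) (w : 'rV[R]_2) : 0 <= T ->
  primitive 0 T (fun t => dot x w + \int[mu]_(s in `[0, t]) dot (f (X s) (alpha s)) w)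
    (fun s => dot (f (X s) (alpha s)) w).
Proof.
move=> T0.
have m j := limit_drift_measurable j T0.
apply: (@integral_primitive _ _ _ _ _ (`|w 0 0| * M + `|w 0 1| * M)).
  rewrite (_ : (fun s => _) = fun s =>
    f (X s) (alpha s) 0 0 * w 0 0 + f (X s) (alpha s) 0 1 * w 0 1); last first.
    by apply/funext => s; rewrite dotE.
  by apply: measurable_funD; apply: measurable_funM => //; exact: m.
move=> r _; rewrite dotE; apply: le_trans (ler_normD _ _) _.
by rewrite !normrM ![`|f _ _ _ _| * _]mulrC; apply: lerD; apply: ler_wpM2l.
Qed.

Lemma limit_dot_balance (t : R) (w : 'rV[R]_2) : 0 < t ->
  dot (X t + k t) w =
  dot x w + \int[mu]_(s in `[0, t]) dot (f (X s) (alpha s)) w.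
Proof.
move=> t0; have T0 := ltW t0.
have H j := integral_primitive (x 0 j)
  (limit_drift_measurable j T0) (fun r _ => drift_coord_le X r j).
have zero (r : R) : 1 * (w 0 0 * f (X r) (alpha r) 0 0 + w 0 1 * f (X r) (alpha r) 0 1) +
    -1 * dot (f (X r) (alpha r)) w = 0 by rewrite dotE; ring.
have := eq_primitive (fun _ _ => erefl) (fun r _ => zero r)
  (primitive_linear 1 (-1) (primitive_linear (w 0 0) (w 0 1) (H 0) (H 1))
    (limit_drift_primitive w T0)).
move=> /primitiveB => /(_ _ _ (lexx 0) T0 (lexx t)).
rewrite Rintegral_cst// mul0r set_itv1 !Rintegral_set1 !addr0.
rewrite -!(limit_balance)// !dotE !mxE.
set I := \int[mu]_(_ in _) _ => E; lra.
Qed.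

(** [X] and [k] may each jump away from their initial data at time 0, but their sum starts from
    [x]. *)
Lemma limit_dot_cvg0 (w : 'rV[R]_2) :
  dot (X t + k t) w @[t --> 0^'+] --> dot x w.
Proof.
have := primitive_continuous (limit_drift_primitive w ler01).
move=> /(continuous_within_itvP _ ltr01)[_ + _].
rewrite set_itv1 Rintegral_set1 addr0; apply: cvg_trans; apply: near_eq_cvg.
near=> t; rewrite limit_dot_balance//.
Unshelve. all: by end_near. Qed.

Lemma limit_dot_continuous (s t : R) (w : 'rV[R]_2) : 0 < s ->
  {within `[s, t], continuous (fun r => dot (X r) w)}.
Proof.
move=> s0; have /subspace_continuousP cX :=
  cvg_loc_unif_continuous (t := t) s0 (fun n => (Y_sol n).1) Y_cvg.
apply/subspace_continuousP => r rst.
have -> : (fun r => dot (X r) w) = fun r => X r 0 0 * w 0 0 + X r 0 1 * w 0 1.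
  by apply/funext => z; rewrite dotE.
have c j : X r' 0 j @[r' --> within `[s, t] (nbhs r)] --> X r 0 j.
  by apply: (cvg_comp _ (fun u : 'rV[R]_2 => u 0 j) (cX r rst)); exact: coord_continuous.
by apply: cvgD; apply: cvgM; [exact: c|exact: cvg_cst|exact: c|exact: cvg_cst].
Qed.

Lemma limit_penalization_continuous (s t : R) (w : 'rV[R]_2) : 0 < s ->
  {within `[s, t], continuous (fun r => dot (k r) w)}.
Proof.
move=> s0; have /subspace_continuousP cX := limit_dot_continuous (t := t) (w := w) s0.
have /primitive_continuous/subspace_continuousP cS :=
  limit_sum_primitive t w s0.
apply/subspace_continuousP => r rst.
have -> : (fun r => dot (k r) w) = fun r => dot (X r + k r) w - dot (X r) w.
  by apply/funext => z; rewrite dotDl addrC addKr.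
by apply: cvgB; [exact: cS|exact: cX].
Qed.

(** * Constancy of the component of [k] along the ray *)

Let pair n (T : R) i := ode_penalized_pair (T := T) (Y_sol n) (fun=> erefl)
  (drift_coord_le (Y n)) i.

Let dot_drift_le n i r : `|dot (f (Y n r) (alpha r)) (unit_dir i)| <= M.
Proof. exact: le_trans (dot_unit_dir_le_enorm _ _) (f_bounded _ _). Qed.

Let perp_drift_le n i r : `|dot (f (Y n r) (alpha r)) (perp (unit_dir i))| <= M.
Proof. exact: le_trans (dot_perp_le_enorm _ _) (f_bounded _ _). Qed.

Let rate_ge0 n : 0 <= 2 * (eps n)^-1.
Proof. by rewrite mulr_ge0// invr_ge0 ltW. Qed.

(** For large [n], [Y n] is within [eta] of [X] on [[s, t]], so that [p >= delta - eta] and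
    [|q| <= eta]; the transverse estimate then passes to the limit with [eta] fixed. *)
Lemma penalization_small (delta eta s t : R) i : 0 < s -> s <= t ->
  0 < eta -> eta < delta ->
  (forall r, s <= r <= t -> delta <= dot (X r) (unit_dir i)) ->
  (forall r, s <= r <= t -> dot (X r) (perp (unit_dir i)) = 0) ->
  0 <= dot (k t) (unit_dir i) - dot (k s) (unit_dir i) <=
    (2 * eta * M * (t - s) + eta ^+ 2) / (2 * (delta - eta)).
Proof.
move=> s0 st e0 ed Xd Xp.
have t0 := lt_le_trans s0 st.
have kc r : 0 < r -> dot (penalization (eps n) (Y n) r) (unit_dir i) @[n --> \oo] -->
    dot (k r) (unit_dir i).
  exact: (cvg_loc_unif_lipschitz (F := dot^~ _) (dot_unit_dir_1lipschitz i) k_cvg).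
have dk : dot (penalization (eps n) (Y n) t) (unit_dir i) -
    dot (penalization (eps n) (Y n) s) (unit_dir i) @[n --> \oo] -->
    dot (k t) (unit_dir i) - dot (k s) (unit_dir i).
  by apply: cvgB; exact: kc.
suff H : \forall n \near \oo,
    0 <= dot (penalization (eps n) (Y n) t) (unit_dir i) -
    dot (penalization (eps n) (Y n) s) (unit_dir i) <=
    (2 * eta * M * (t - s) + eta ^+ 2) / (2 * (delta - eta)).
  apply/andP; split.
    by apply: (cvgr_to_ge dk); apply: filterS H => n /andP[].
  by apply: (cvgr_to_le dk); apply: filterS H => n /andP[].
have := cvg_loc_unif_enorm t Y_cvg s0 e0; apply: filterS => n close.
have := pair n i (ltW t0); rewrite /penalized_pair => -[pp qp].
have pq := conj (primitive_subitv (ltW s0) (lexx t) pp)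
  (primitive_subitv (ltW s0) (lexx t) qp).
have := primitive_subitv (ltW s0) (lexx t)
  (penalization_primitive (c := (eps n)^-1) (Y_sol n) t i).
apply: (transverse_penalization_small (rate_ge0 n) pq (perp_drift_le n i) st);
  rewrite ?subr_gt0// => r rst.
- have := Xd r rst.
  have := le_lt_trans (dot_unit_dir_le_enorm (Y n r - X r) i) (close r rst).
  rewrite dotBl ltr_norml => /andP[]; lra.
- have := Xp r rst.
  have := le_lt_trans (dot_perp_le_enorm (Y n r - X r) i) (close r rst).
  by rewrite dotBl => /[swap] ->; rewrite subr0 => /ltW.
Qed.

(** Take for [delta] the positive minimum of [<X, e>] on [[s, t]] and let [eta] tend to 0 in
    [penalization_small]. *)
Lemma penalization_const (s t : R) i : 0 < s -> s <= t ->
  (forall r, s <= r <= t -> 0 < dot (X r) (unit_dir i)) ->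
  (forall r, s <= r <= t -> dot (X r) (perp (unit_dir i)) = 0) ->
  dot (k t) (unit_dir i) = dot (k s) (unit_dir i).
Proof.
move=> s0 st Xd Xp.
have [c cst Xc] := EVT_min st (limit_dot_continuous (w := unit_dir i) s0).
have d0 := Xd c cst; set d := dot (X c) _ in Xc d0.
pose D := dot (k t) (unit_dir i) - dot (k s) (unit_dir i).
(* For [eta <= 1] and [eta <= d / 2] one has [eta^2 <= eta] and [2 (d - eta) >= d], so the bound is
   at most [C eta]. *)
pose C := (2 * M * (t - s) + 1) / d.
have C0 : 0 < C.
  by rewrite divr_gt0// ltr_wpDl// mulr_ge0 ?subr_ge0// mulr_ge0.
have small eta : 0 < eta -> eta <= 1 -> eta <= d / 2 -> 0 <= D <= C * eta.
  move=> e0 e1 ed.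
  have ed' : eta < d by apply: le_lt_trans ed _; lra.
  have /andP[D0 DC] := penalization_small s0 st e0 ed' Xc Xp.
  rewrite /D D0/=; apply: le_trans DC _.
  rewrite ler_pdivrMr; last by rewrite mulr_gt0// subr_gt0.
  apply: (@le_trans _ _ (C * eta * d)).
    have -> : C * eta * d = (2 * M * (t - s) + 1) * eta.
      by rewrite /C; field; rewrite gt_eqF.
    have : eta * eta <= 1 * eta by rewrite ler_wpM2r// ltW.
    rewrite mulrDl expr2; lra.
  apply: ler_wpM2l; first by rewrite mulr_ge0// ltW.
  lra.
have D0 : 0 <= D.
  suff /andP[] : 0 <= D <= C * Num.min 1 (d / 2) by [].
  apply: small; rewrite ?ge_min ?lexx ?orbT//.
  by rewrite lt_min ltr01/= divr_gt0.
apply/eqP; rewrite -subr_eq0 -/D; apply/negP => /negP Dn0.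
have Dgt0 : 0 < D by rewrite lt_neqAle eq_sym Dn0.
have DC0 : 0 < D / (2 * C) by rewrite divr_gt0// mulr_gt0.
(* The last entry forces [C eta <= D / 2], against [0 < D <= C eta]. *)
pose eta := Num.min (Num.min 1 (d / 2)) (D / (2 * C)).
have /andP[_] : 0 <= D <= C * eta.
  apply: small; rewrite /eta ?ge_min ?lexx ?orbT//.
  by rewrite !lt_min ltr01 DC0 divr_gt0.
have : C * eta <= C * (D / (2 * C)) by rewrite ler_wpM2l ?ge_min ?lexx ?orbT// ltW.
have -> : C * (D / (2 * C)) = D / 2 by field; rewrite gt_eqF.
lra.
Qed.

(** * The hyperbolic quantity and the sign of [p] near time 0 *)

Let penalized_hyperbolic_drift n i (t : R) : 0 <= t <= 2^-1 ->
  `|hyperbolic (Y n t) i - hyperbolic x i| <= hyperbolic_rate M x i * t.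
Proof.
move=> /andP[t0 t2]; have := hyperbolic_drift (rate_ge0 n) (pair n i t0)
  (dot_drift_le n i) (perp_drift_le n i) (r := t) t0 _ _.
by rewrite (ode_init (Y_sol n)) !subr0 t0 lexx t2 => /(_ isT isT).
Qed.

Lemma limit_hyperbolic_drift i (t : R) : 0 < t <= 2^-1 ->
  `|hyperbolic (X t) i - hyperbolic x i| <= hyperbolic_rate M x i * t.
Proof.
move=> /andP[t0 t2].
have c1 : dot (Y n t) (unit_dir i) @[n --> \oo] --> dot (X t) (unit_dir i).
  exact: (cvg_loc_unif_lipschitz (F := dot^~ _) (dot_unit_dir_1lipschitz i) Y_cvg).
have c2 : dot (Y n t) (perp (unit_dir i)) @[n --> \oo] --> dot (X t) (perp (unit_dir i)).
  exact: (cvg_loc_unif_lipschitz (F := dot^~ _) (dot_perp_1lipschitz i) Y_cvg).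
have c3 : `|hyperbolic (Y n t) i - hyperbolic x i| @[n --> \oo] -->
    `|hyperbolic (X t) i - hyperbolic x i|.
  apply: cvg_norm; apply: cvgB; last exact: cvg_cst.
  by apply: cvgB; apply: cvgM.
apply: (cvgr_to_le c3); apply: nearW => n.
by apply: penalized_hyperbolic_drift; rewrite (ltW t0).
Qed.

(** Where [p] vanishes, [p^2 - q^2 <= 0], whereas the drift bound keeps it positive up to time [t].
    So [p] keeps its negative sign along each [Y n], and the limit is nonpositive. *)
Lemma limit_sign i (t : R) : 0 < t <= 2^-1 ->
  hyperbolic_rate M x i * t < hyperbolic x i ->
  dot x (unit_dir i) < 0 -> dot (X t) (unit_dir i) <= 0.
Proof.
move=> /andP[t0 t2] Ct x0.
have c1 : dot (Y n t) (unit_dir i) @[n --> \oo] --> dot (X t) (unit_dir i).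
  exact: (cvg_loc_unif_lipschitz (F := dot^~ _) (dot_unit_dir_1lipschitz i) Y_cvg).
apply: (cvgr_to_le c1); apply: nearW => n; apply: ltW.
have [/primitive_continuous cp _] := pair n i (ltW t0).
apply: (nonvanishing_lt0 cp); rewrite ?(ode_init (Y_sol n))// ?lexx ?(ltW t0)//.
move=> r /andP[r0 rt]; apply/negP => /eqP p0.
have := penalized_hyperbolic_drift n i (t := r); rewrite r0 (le_trans rt t2) => /(_ isT).
have rate0 : 0 <= hyperbolic_rate M x i.
  rewrite mulr_ge0 ?mulr_ge0//; have := sqr_ge0 M.
  have := sqr_ge0 (dot x (unit_dir i)); have := sqr_ge0 (dot x (perp (unit_dir i))); lra.
have : hyperbolic_rate M x i * r <= hyperbolic_rate M x i * t by rewrite ler_wpM2l.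
rewrite [hyperbolic (Y n r) i]/hyperbolic p0 expr0n /= ler_norml => ? /andP[? _].
have := sqr_ge0 (dot (Y n r) (perp (unit_dir i))); lra.
Qed.

End omega_limit.

(** * Limit of the gradient flow *)

Section gradient_flow.
Context {R : realType}.

(** The decay estimate gives [4 t q(t)^4 <= q(0)^2], so [q] tends to 0; conservation gives
    [p^2 = rho^2 + q^2], and [p] stays positive if [rho > 0], so [p] tends to [rho]. *)
Lemma gradient_flow_cvg (x : 'rV[R]_2) (Z : R -> 'rV[R]_2) (rho : R) i :
  ode_solution (fun _ z => - gradient dpot z) x Z -> 0 <= rho ->
  hyperbolic x i = rho ^+ 2 ->
  (0 < rho -> 0 < dot x (unit_dir i)) ->
  Z t @[t --> +oo] --> rho *: unit_dir i.
Proof.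
move=> Zsol rho0 hyp pos.
pose P t := dot (Z t) (unit_dir i); pose Q t := dot (Z t) (perp (unit_dir i)).
have pq (t : R) : 0 <= t -> penalized_pair (2 * 1) 0 t P Q (fun=> 0) (fun=> 0).
  move=> t0.
  have [|s j|pP pQ] := ode_penalized_pair (G := fun=> 0) (c := 1) (M := 0) Zsol _ _ i t0.
  - by move=> s; rewrite scale1r sub0r.
  - by rewrite mxE normr0.
  - by split; [apply: eq_primitive pP|apply: eq_primitive pQ] => // r _;
      rewrite [dot 0 _]dotE !mxE !mul0r addr0.
have P0 : P 0 = dot x (unit_dir i) by rewrite /P (ode_init Zsol).
have Q0 : Q 0 = dot x (perp (unit_dir i)) by rewrite /Q (ode_init Zsol).
have cons (t : R) : 0 <= t -> P t ^+ 2 - Q t ^+ 2 = rho ^+ 2.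
  by move=> t0; rewrite (gradient_flow_conserved t0 (pq t t0)) P0 Q0.
have Ppos (t : R) : 0 < rho -> 0 <= t -> 0 < P t.
  move=> r0 t0; rewrite -oppr_lt0; have [pP _] := pq t t0.
  have cP := primitive_continuous (primitive_linear (-1) 0 pP pP).
  rewrite -[X in X < 0]addr0 -mulN1r -[X in _ + X < 0](mul0r (P t)).
  apply: (nonvanishing_lt0 cP (t := t)); rewrite ?lexx ?t0//.
    move=> r /andP[r1 _]; rewrite mul0r addr0 mulN1r oppr_eq0.
    apply/negP => /eqP Pr; have := cons r r1; rewrite Pr expr0n /= => H.
    have r2 : 0 < rho ^+ 2 by rewrite exprn_gt0.
    by have := sqr_ge0 (Q r); lra.
  by rewrite mul0r addr0 mulN1r oppr_lt0 P0 pos.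
(* If [rho = 0] then [p^2 = q^2]. Otherwise [p >= rho] and [(p - rho)^2 = q^2 - 2 rho (p - rho)]. *)
have close (t : R) : 0 <= t -> `|P t - rho| <= `|Q t|.
  move=> t0; rewrite -ler_sqr ?nnegrE// !real_normK ?num_real//.
  have := cons t t0; move: rho0; rewrite le_eqVlt => /predU1P[<-|r0].
    by rewrite expr0n /= !subr0; lra.
  have := Ppos t r0 t0 => Pt C.
  have rP : rho <= P t.
    rewrite -ler_sqr ?nnegrE; [|exact: ltW|exact: ltW].
    have := sqr_ge0 (Q t); lra.
  have : 0 <= rho * (P t - rho) by rewrite mulr_ge0 ?subr_ge0// ltW.
  rewrite sqrrB !expr2 in C *; lra.
have cQ : Q t @[t --> +oo] --> 0.
  apply/cvgrPdist_lt => e e0; near=> t.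
  have t1 : Q 0 ^+ 2 / e ^+ 4 < t by near: t; exact/nbhs_pinfty_gt/num_real.
  have t0 : 0 < t by near: t; exact/nbhs_pinfty_gt/num_real.
  rewrite sub0r normrN ltNge; apply/negP => eQ.
  have D0 : 0 <= P 0 ^+ 2 - Q 0 ^+ 2 by rewrite cons// sqr_ge0.
  have := gradient_flow_decay _ (ltW t0) (pq t (ltW t0)) D0.
  rewrite mulr1 => /(_ (ler0n _ 2)); rewrite subr0.
  move: t1; rewrite ltr_pdivrMr ?exprn_gt0// => t1.
  have e4 : e ^+ 4 <= Q t ^+ 4.
    have -> : Q t ^+ 4 = `|Q t| ^+ 4 by rewrite -normrX ger0_norm// exprn_even_ge0.
    by rewrite ler_pXn2r ?nnegrE// ltW.
  have : t * e ^+ 4 <= t * Q t ^+ 4 by rewrite ler_wpM2l// ltW.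
  have : 0 < t * e ^+ 4 by rewrite mulr_gt0// exprn_gt0.
  lra.
have cP : P t @[t --> +oo] --> rho.
  apply/cvgrPdist_lt => e e0; near=> t.
  have t0 : 0 < t by near: t; exact/nbhs_pinfty_gt/num_real.
  rewrite distrC; apply: le_lt_trans (close t (ltW t0)) _.
  by rewrite -[Q t]subr0 distrC; near: t; move/cvgrPdist_lt: cQ; exact.
rewrite (_ : Z = fun t => P t *: unit_dir i + Q t *: perp (unit_dir i)); last first.
  by apply/funext => t; exact: ray_decomposition.
rewrite -[_ *: _]addr0 -(scale0r (perp (unit_dir i))).
by apply: cvgD; apply: cvgZr_tmp.
Unshelve. all: by end_near. Qed.

End gradient_flow.

(** * Left end point of an excursion *)

Section excursions.
Context {R : realType} {X : R -> 'rV[R]_2} {a : R} {b : \bar R}.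
Hypothesis ab : excursion X a b.

Lemma excursion_nonempty : exists2 t, 0 < t & a < t /\ (t%:E < b)%E.
Proof.
have [t [t0 Xt] E] := ab; exists t => //.
have : time_interval a b t by rewrite E; apply: connected_component_refl.
by [].
Qed.

Lemma excursion_start_ge0 : 0 <= a.
Proof.
have [t [t0 Xt] E] := ab; rewrite leNgt; apply/negP => a0.
have [s s0 [as_ sb]] := excursion_nonempty.
have a20 : a / 2 < 0 by rewrite pmulr_llt0.
have : time_interval a b (a / 2).
  split; first by lra.
  by apply: lt_trans sb; rewrite lte_fin; lra.
rewrite E => /connected_component_sub[+ _].
by rewrite ltNge ltW.
Qed.

(** Otherwise [[a, t]] would be a connected set of positive times with [X] nonzero, and [a] would
    belong to its own open excursion. *)
Lemma excursion_start_zero : 0 < a -> X a = 0.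
Proof.
move=> a0; have [t Ct E] := ab; apply: contrapT => Xa.
have [at_ tb] : time_interval a b t by rewrite E; apply: connected_component_refl.
have sub : `[a, t] `<=` [set t | 0 < t /\ X t <> 0].
  move=> r /=; rewrite in_itv/= => /andP[].
  rewrite le_eqVlt => /predU1P[<-//|ar] rt.
  have : time_interval a b r by split => //; apply: le_lt_trans tb; rewrite lee_fin.
  by rewrite E => /connected_component_sub.
have : time_interval a b a.
  rewrite E; apply: (@connected_component_max _ _ `[a, t]) => //.
  - by rewrite /= in_itv/= lexx ltW.
  - exact: segment_connected.
  - by rewrite /= in_itv/= lexx ltW.
by case; rewrite ltxx.
Qed.

End excursions.

(** * Integral formulas for [X] and [k] on an excursion *)

Lemma vintegral_primitive (R : realType) (s t : R) (u phi : R -> R) (w : 'rV[R]_2) :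
  s <= t -> primitive s t u phi ->
  vintegral s t (fun r => phi r *: w) = (u t - u s) *: w.
Proof.
move=> st up; apply/rowP => j; rewrite !mxE.
under eq_Rintegral do rewrite mxE.
rewrite RintegralZr//; last exact: (primitive_integrable (lexx s) (lexx t) up).
by rewrite (primitiveB (lexx s) st (lexx t) up).
Qed.

Theorem theorem2p2 (R : realType) (A : metricType R)
    (A_compact : compact [set: A])
    (f : 'rV[R]_2 -> A -> 'rV[R]_2)
    (f_continuous : continuous (fun p : 'rV[R]_2 * A => f p.1 p.2))
    (M : R) (M_gt0 : 0 < M)
    (f_bounded : forall x c, enorm (f x c) <= M)
    (f_lipschitz : forall x y c, enorm (f x c - f y c) <= M * enorm (x - y))
    (x : 'rV[R]_2) (alpha : R -> A) (alpha_control : control alpha)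
    (X k : R -> 'rV[R]_2) (Xk_omega : omega_limit f x alpha X k)
    (a : R) (b : \bar R) (ab_excursion : excursion X a b)
    (i : direction) (X_ray : X @` time_interval a b `<=` open_ray i) :
  let e : 'rV[R]_2 := unit_dir i in
  let v s := f (X s) (alpha s) in
  (a = 0 ->
     forall Z, ode_solution (fun _ z => - gradient dpot z) x Z ->
     let xbar := lim (Z t @[t --> +oo]) in
     [/\ X t @[t --> 0^'+] --> xbar,
         k t @[t --> 0^'+] --> x - xbar &
         forall t : R, 0 < t -> (t%:E <= b)%E ->
           X t = xbar + vintegral 0 t (fun s => dot (v s) e *: e) /\
           k t = x - xbar +
                 vintegral 0 t (fun s => dot (v s) (perp e) *: perp e)]) /\
  (a <> 0 ->
     forall t : R, a <= t -> (t%:E <= b)%E ->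
       X t = vintegral a t (fun s => dot (v s) e *: e) /\
       k t = k a + vintegral a t (fun s => dot (v s) (perp e) *: perp e)).
Proof.
move=> e v.
have [_ _ [eps [Y [[eps_gt0 _] Y_sol Y_cvg k_cvg]]]] := Xk_omega.
have a_ge0 := excursion_start_ge0 ab_excursion.
have ray r : a < r -> (r%:E < b)%E -> 0 < dot (X r) e /\ dot (X r) (perp e) = 0.
  by move=> ar rb; apply: open_rayP; apply: X_ray; exists r.
have cX s t w : 0 < s -> {within `[s, t], continuous (fun r => dot (X r) w)}.
  exact: (limit_dot_continuous Y_sol Y_cvg).
have ck s t w : 0 < s -> {within `[s, t], continuous (fun r => dot (k r) w)}.
  exact: (limit_penalization_continuous f_bounded f_lipschitz Y_sol Y_cvg k_cvg).
have inner s t r : a <= s -> (t%:E <= b)%E -> s < r < t -> a < r /\ (r%:E < b)%E.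
  move=> sa tb /andP[sr rt]; split; first exact: le_lt_trans sr.
  by apply: lt_le_trans tb; rewrite lte_fin.
have X_perp s t : a <= s -> 0 < s -> s < t -> (t%:E <= b)%E ->
    forall r, s <= r <= t -> dot (X r) (perp e) = 0.
  move=> sa s0 st tb; apply: (continuous_itv_const st (cX s t (perp e) s0)) => r srt.
  by have [ar rb] := inner s t r sa tb srt; have [] := ray r ar rb.
have k_const s t : a <= s -> 0 < s -> s <= t -> (t%:E <= b)%E ->
    dot (k t) e = dot (k s) e.
  move=> sa s0; rewrite le_eqVlt => /predU1P[->//|st] tb.
  (* [penalization_const] needs [<X, e> > 0] on a closed interval, so it is applied strictly inside
     []s, t[]; continuity of [k] then reaches the end points, with [k m] as reference value. *)
  pose m := (s + t) / 2.
  have srt : s < m < t by rewrite /m; apply/andP; split; lra.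
  have E := continuous_itv_const st (ck s t e s0) (l := dot (k m) e).
  suff H : forall r, s < r < t -> dot (k r) e = dot (k m) e.
    by rewrite !E// lexx ltW.
  have aux p q : s < p -> p <= q -> q < t -> dot (k q) e = dot (k p) e.
    move=> sp pq qt.
    apply: (penalization_const f_bounded eps_gt0 Y_sol Y_cvg k_cvg _ pq).
    - exact: lt_trans sp.
    - move=> r /andP[pr rq]; have [] := inner s t r sa tb _.
        by rewrite (lt_le_trans sp pr) (le_lt_trans rq qt).
      by move=> ar rb; have [] := ray r ar rb.
    - move=> r /andP[pr rq]; have [] := inner s t r sa tb _.
        by rewrite (lt_le_trans sp pr) (le_lt_trans rq qt).
      by move=> ar rb; have [] := ray r ar rb.
  move=> r /andP[sr rt]; have /andP[sm mt] := srt.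
  by case/orP: (le_total r m) => rm; [rewrite (aux r m)|rewrite (aux m r)].
split=> [a0 Z Zsol|/eqP a0].
  have [t0 t0_gt0 [_ t0b]] := excursion_nonempty ab_excursion.
  (* [<k, e>] is constant and [X + k] tends to [x], so [rho] is the right limit of [<X, e>] at 0. *)
  pose rho := dot x e - dot (k t0) e.
  have k_e t : 0 < t -> (t%:E <= b)%E -> dot (k t) e = dot (k t0) e.
    move=> tgt0 tb; case/orP: (le_total t t0) => tt0.
      by rewrite (k_const t t0) ?a0// ltW.
    by rewrite (k_const t0 t) ?a0// ltW.
  have balance t w : 0 < t -> dot (X t + k t) w =
      dot x w + \int[@lebesgue_measure R]_(s in `[0, t]) dot (v s) w.
    exact: (limit_dot_balance f_bounded f_lipschitz Y_sol Y_cvg k_cvg).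
  have cvg0 w : dot (X t + k t) w @[t --> 0^'+] --> dot x w.
    exact: (limit_dot_cvg0 f_bounded f_lipschitz Y_sol Y_cvg k_cvg).
  have near0 : \forall t \near 0^'+, [/\ 0 < t, (t%:E <= b)%E,
      0 < dot (X t) e & dot (X t) (perp e) = 0].
    near=> t; have t_gt0 : 0 < t by near: t; exact: nbhs_right_gt.
    have tb : (t%:E < b)%E.
      apply: lt_trans t0b; rewrite lte_fin; near: t; exact: nbhs_right_lt.
    by have [||Xe Xp] := ray t; rewrite ?a0//; split=> //; exact: ltW.
  have Xe_cvg : dot (X t) e @[t --> 0^'+] --> rho.
    have : dot (X t + k t) e - dot (k t0) e @[t --> 0^'+] --> rho.
      by apply: cvgB; [exact: cvg0|exact: cvg_cst].
    apply: cvg_trans; apply: near_eq_cvg; apply: filterS near0 => t [t_gt0 tb _ _].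
    by rewrite dotDl k_e// addrK.
  have rho_ge0 : 0 <= rho.
    by apply: (cvgr_to_ge Xe_cvg); apply: filterS near0 => t [_ _ /ltW].
  (* On the ray the hyperbolic quantity of [X t] is [<X t, e>^2], which tends to [rho^2]; the drift
     bound forces the same limit to be that of [x]. *)
  have rho2 : hyperbolic x i = rho ^+ 2.
    have c1 : `|hyperbolic (X t) i - hyperbolic x i| @[t --> 0^'+] -->
        `|rho ^+ 2 - hyperbolic x i|.
      apply: cvg_norm; apply: cvgB; last exact: cvg_cst.
      have : dot (X t) e * dot (X t) e @[t --> 0^'+] --> rho * rho by apply: cvgM.
      rewrite expr2; apply: cvg_trans; apply: near_eq_cvg.
      by apply: filterS near0 => t [_ _ _ Xp]; rewrite /hyperbolic Xp; rewrite -/e; ring.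
    have c2 : hyperbolic_rate M x i * t @[t --> (0:R)^'+] --> hyperbolic_rate M x i * 0.
      apply: cvgM; first exact: cvg_cst.
      by apply: cvg_within_filter; exact: cvg_id.
    apply/esym/eqP; rewrite -subr_eq0 -normr_le0 -(mulr0 (hyperbolic_rate M x i)).
    apply: (ler_cvg_to c1 c2); near=> t.
    apply: (limit_hyperbolic_drift f_bounded eps_gt0 Y_sol Y_cvg).
    apply/andP; split; near: t; first exact: nbhs_right_gt.
    by apply: nbhs_right_le; rewrite invr_gt0.
  (* [<x, e> = 0] would make the hyperbolic quantity of [x] nonpositive, and [<x, e> < 0] would give
     [<X t, e> <= 0] for small [t], off the ray. *)
  have x_pos : 0 < rho -> 0 < dot x e.
    move=> rho_gt0; have hyp_gt0 : 0 < hyperbolic x i by rewrite rho2 exprn_gt0.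
    rewrite lt_neqAle; apply/andP; split.
      apply/negP => /eqP xe0; move: hyp_gt0; rewrite /hyperbolic -/e -xe0 expr0n /=.
      by have := sqr_ge0 (dot x (perp e)); lra.
    rewrite leNgt; apply/negP => xe_lt0.
    have rate_ge0 : 0 < hyperbolic_rate M x i.
      rewrite mulr_gt0 ?mulr_gt0//; have := sqr_ge0 M.
      have := sqr_ge0 (dot x e); have := sqr_ge0 (dot x (perp e)); rewrite /e; lra.
    have : \forall t \near (0:R)^'+, False.
      near=> t.
      have [t_gt0 _ Xe _] : [/\ 0 < t, (t%:E <= b)%E,
        0 < dot (X t) e & dot (X t) (perp e) = 0] by near: t.
      suff : dot (X t) e <= 0 by rewrite leNgt Xe.
      apply: (limit_sign f_bounded eps_gt0 Y_sol Y_cvg _ _ xe_lt0).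
        by rewrite t_gt0; near: t; apply: nbhs_right_le; rewrite invr_gt0.
      by rewrite mulrC -ltr_pdivlMr//; near: t; apply: nbhs_right_lt; exact: divr_gt0.
    by move/filter_ex => [].
  have -> : lim (Z t @[t --> +oo]) = rho *: e.
    apply: norm_cvg_lim; exact: (gradient_flow_cvg Zsol rho_ge0 rho2 x_pos).
  have x_sub : x - rho *: e = dot (k t0) e *: e + dot x (perp e) *: perp e.
    rewrite {1}(ray_decomposition x i) -/e addrAC -scalerBl; congr (_ *: _ + _).
    by rewrite /rho; ring.
  split.
  - have : dot (X t) e *: e @[t --> 0^'+] --> rho *: e by apply: cvgZr_tmp.
    apply: cvg_trans; apply: near_eq_cvg; apply: filterS near0 => t [_ _ _ Xp].
    by rewrite [RHS](ray_decomposition _ i) -/e Xp scale0r addr0.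
  - have : dot (k t0) e *: e + dot (X t + k t) (perp e) *: perp e @[t --> 0^'+] -->
        x - rho *: e.
      by rewrite x_sub; apply: cvgD; [exact: cvg_cst|exact: cvgZr_tmp].
    apply: cvg_trans; apply: near_eq_cvg; apply: filterS near0 => t [t_gt0 tb _ Xp].
    by rewrite [RHS](ray_decomposition _ i) -/e dotDl Xp add0r k_e.
  move=> t t_gt0 tb.
  have Xp : dot (X t) (perp e) = 0.
    (* [X_perp] needs an interval with positive left end; any interval ending at [t] will do. *)
    have t2 : 0 < t / 2 by rewrite divr_gt0.
    have t2t : t / 2 < t by rewrite ltr_pdivrMr// ltr_pMr// ltr1n.
    by apply: (X_perp (t / 2) t) => //; rewrite ?a0 ?lexx ?andbT ltW.
  have prim w := limit_drift_primitive f_bounded f_lipschitz Y_sol Y_cvg w (ltW t_gt0).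
  rewrite !(vintegral_primitive _ (ltW t_gt0) (prim _)).
  rewrite set_itv1 !Rintegral_set1 !addr0 -!balance// !dotDl Xp k_e// add0r.
  split.
    rewrite {1}(ray_decomposition (X t) i) -/e Xp scale0r addr0 -scalerDl.
    by congr (_ *: _); rewrite /rho; ring.
  rewrite x_sub {1}(ray_decomposition (k t) i) -/e k_e// -addrA -scalerDl.
  by congr (_ + _ *: _); ring.
have a_gt0 : 0 < a by rewrite lt_neqAle eq_sym a0.
have Xa := excursion_start_zero ab_excursion a_gt0.
move=> t a_le_t tb.
have prim w := limit_sum_primitive f_bounded f_lipschitz Y_sol Y_cvg k_cvg t w a_gt0.
rewrite !(vintegral_primitive _ a_le_t (prim _)) !dotDl.
have Xt : dot (X t) (perp e) = 0.
  move: a_le_t; rewrite le_eqVlt => /predU1P[<-|a_lt_t].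
    by rewrite Xa dotE !mxE !mul0r addr0.
  by apply: (X_perp a t) => //; rewrite lexx ltW.
(* The integrals are increments of [X + k]. Along [e] only [X] varies, starting from 0; across, [X]
   vanishes at both ends and only [k] varies. *)
have dXa w : dot (X a) w = 0 by rewrite Xa dotE !mxE !mul0r addr0.
rewrite Xt !dXa (k_const a t)// !add0r; split.
  by rewrite {1}(ray_decomposition (X t) i) Xt scale0r addr0 addrK.
rewrite {1}(ray_decomposition (k t) i) {1}(ray_decomposition (k a) i).
by rewrite -/e (k_const a t)// -addrA -scalerDl addrCA subrr addr0.
Unshelve. all: by end_near. Qed.
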